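(* Let $A\in\mathcal{M}_d(\mathbb{C})$ be self-adjoint, let $\mathcal{X},\mathcal{Y}\subset\mathbb{C}^d$ be subspaces of dimension $k$, and let $X,Y\in\mathcal{M}_{d,k}(\mathbb{C})$ have columns forming orthonormal bases of $\mathcal{X}$ and $\mathcal{Y}$, respectively. If $\Theta_1(\mathcal{X},\mathcal{Y})<\frac{\pi}{2}$, then $$|\lambda(\rho(X))-\lambda(\rho(Y))|\prec_w \frac{s(P_{\mathcal{Y}}R_X)+s(P_{\mathcal{X}}R_Y)}{\cos(\Theta(\mathcal{X},\mathcal{Y}))}$$ and $$|\lambda(\rho(X))-\lambda(\rho(Y))|\prec_w \big[s(P_{\mathcal{X}+\mathcal{Y}}R_X)+s(P_{\mathcal{X}+\mathcal{Y}}R_Y)\big]\,\tan(\Theta(\mathcal{X},\mathcal{Y})).$$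
   Context: $\mathcal{M}_{d,k}(\mathbb{C})$ is the space of complex $d\times k$ matrices and $\mathcal{M}_d(\mathbb{C})=\mathcal{M}_{d,d}(\mathbb{C})$. Set $\rho(X)=X^*AX$ and $\rho(Y)=Y^*AY$ ($k\times k$ self-adjoint matrices), and $R_X=AX-X\rho(X)$, $R_Y=AY-Y\rho(Y)$ ($d\times k$ matrices). $P_{\mathcal{Z}}$ is the orthogonal projection of $\mathbb{C}^d$ onto a subspace $\mathcal{Z}$. For a self-adjoint matrix $C$, $\lambda(C)$ is the vector of eigenvalues counted with multiplicity in non-increasing order. For a $d\times k$ matrix $B$ (with $k\le d$), $s(B)\in\mathbb{R}_{\ge0}^k$ is the vector of singular values (eigenvalues of $(B^*B)^{1/2}$) in non-increasing order. The principal angles $\Theta(\mathcal{X},\mathcal{Y})=(\Theta_i(\mathcal{X},\mathcal{Y}))_{i=1}^k$, with $\pi/2\ge\Theta_1(\mathcal{X},\mathcal{Y})\ge\dots\ge\Theta_k(\mathcal{X},\mathcal{Y})\ge0$, are defined by $\cos(\Theta_{k-i+1}(\mathcal{X},\mathcal{Y}))=s_i(X^*Y)$, $1\le i\le k$. Operations on vectors (sum, product, quotient, absolute value, and applying a scalar function) are entrywise. For $x,y\in\mathbb{R}^k$, $x\prec_w y$ (submajorization) means $\sum_{i=1}^j x_i^\downarrow\le\sum_{i=1}^j y_i^\downarrow$ for every $1\le j\le k$, where $x^\downarrow$ is $x$ rearranged in non-increasing order. *)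

(* Defs.v *)
From HB Require Import structures.
From mathcomp Require Import all_boot all_order all_algebra.
From mathcomp Require Import sesquilinear spectral complex.
From mathcomp Require Import all_classical all_reals all_analysis.

Set Implicit Arguments.
Unset Strict Implicit.
Unset Printing Implicit Defensive.

Import Order.TTheory GRing.Theory Num.Theory.
Local Open Scope ring_scope.
Local Open Scope sesquilinear_scope.

Section Defs.
Context {R : realType}.
Local Notation C := R[i].

Section Vectors.
Context {k : nat}.
Implicit Types x y : 'rV[R]_k.

Definition decreasing_rearrangement x : 'rV[R]_k :=
  \row_(i < k) (sort >=%R [seq x 0 l | l : 'I_k])`_i.

Definition submajorized x y : Prop :=
  forall j : nat, (1 <= j <= k)%N ->
    \sum_(i < k | (i < j)%N) decreasing_rearrangement x 0 i <=
    \sum_(i < k | (i < j)%N) decreasing_rearrangement y 0 i.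

End Vectors.

(* The roots of the characteristic polynomial, repeated according to
   multiplicity. *)
Definition eigenvalue_seq {n : nat} (M : 'M[C]_n) : seq C :=
  sval (closed_field_poly_normal (char_poly M)).

(* Meant for self-adjoint M, whose eigenvalues are real: taking real parts is
   then only the passage from R[i] to R. *)
Definition eigvals {n : nat} (M : 'M[C]_n) : 'rV[R]_n :=
  \row_(i < n) (sort >=%R [seq complex.Re z | z <- eigenvalue_seq M])`_i.

(* The square root of a positive semidefinite matrix H, by functional calculus:
   H = U^-1 D U with U unitary and D diagonal gives U^-1 D^(1/2) U. *)
Definition psd_sqrt {n : nat} (H : 'M[C]_n) : 'M[C]_n :=
  invmx (spectralmx H) *m diag_mx (map_mx sqrtC (spectral_diag H))
    *m spectralmx H.

Definition singvals {d k : nat} (B : 'M[C]_(d, k)) : 'rV[R]_k :=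
  eigvals (psd_sqrt (B^t* *m B)).

(* The principal angles between the column spaces of X and Y, when X and Y both
   have orthonormal columns. With indices counted from 0, the relation
   cos Theta_(k-i+1) = s_i (X^* Y) reads cos Theta_i = s_(k-1-i) (X^* Y). *)
Definition principal_angles {d k : nat} (X Y : 'M[C]_(d, k)) : 'rV[R]_k :=
  \row_(i < k) acos (singvals (X^t* *m Y) 0 (rev_ord i)).

(* proj_ortho acts on row vectors, on the right; both transpositions turn it
   into a matrix acting on column vectors, on the left. *)
Definition orthoproj {d : nat} (Z : {vspace 'cV[C]_d}) : 'M[C]_d :=
  (proj_ortho (\matrix_(i < \dim Z) ((vbasis Z)`_i)^T))^T.

Definition orthonormal_cols_basis {d k : nat}
    (X : 'M[C]_(d, k)) (V : {vspace 'cV[C]_d}) : Prop :=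
  basis_of V [seq col j X | j : 'I_k] /\ X^t* *m X = 1%:M.

Definition rayleigh {d k : nat} (A : 'M[C]_d) (X : 'M[C]_(d, k)) : 'M[C]_k :=
  X^t* *m A *m X.

Definition residual {d k : nat} (A : 'M[C]_d) (X : 'M[C]_(d, k)) :
    'M[C]_(d, k) :=
  A *m X - X *m rayleigh A X.

End Defs.

(* Main.v *)
(** Write [T = Y^* X], [H = rho(X)], [K = rho(Y)]. Then
    [K T - T H = Y^* R_X - (X^* R_Y)^* =: E], and in the singular bases of [T]
    this is a Sylvester equation [K' S - S H' = E'] with [S] diagonal positive,
    whose Hermitian part is [D S + S D = E' + E'^*] for [D = K' - H']. In an
    orthonormal eigenbasis [w_i] of [D], the eigenvalue [delta_i] satisfies
    [delta_i <w_i, S w_i> = Re <w_i, E' w_i>], hence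
    [|delta_i| <= |Re <w_i, E' w_i>| <w_i, S^-1 w_i>]; Abel summation turns this
    into [|delta| <_w s(E) s(S^-1)], and the Lidskii-Mirsky inequality passes
    from [delta] to [lambda(H) - lambda(K)]. The singular values of [S^-1] are
    the inverse cosines of the angles. For the tangent bound,
    [Y^* R_X = ((1 - X X^* ) Y)^* P R_X] with [P] the projection onto the sum of
    the two spaces, the singular values of the first factor are the sines, and
    Horn's inequality bounds those of the product. *)
Require Import Defs.
From HB Require Import structures.
From mathcomp Require Import all_boot all_order all_algebra.
From mathcomp Require Import sesquilinear spectral complex.
From mathcomp Require Import all_classical all_reals all_analysis.
From mathcomp Require Import perm.
From mathcomp Require Import ring lra zify.

Set Implicit Arguments.
Unset Strict Implicit.
Unset Printing Implicit Defensive.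

Import Order.TTheory GRing.Theory Num.Theory.
Local Open Scope ring_scope.
Local Open Scope sesquilinear_scope.
Local Open Scope complex_scope.

(** * Traces and contractions *)

Section RealPartTrace.
Context {R : realType}.
Local Notation C := R[i].

Lemma adjmxM m n p (A : 'M[C]_(m, n)) (B : 'M[C]_(n, p)) :
  (A *m B)^t* = B^t* *m A^t*.
Proof. by rewrite trmx_mul map_mxM. Qed.

Lemma adjmxB m n (A B : 'M[C]_(m, n)) : (A - B)^t* = A^t* - B^t*.
Proof. by rewrite linearB /= map_mxB. Qed.

Lemma adjmxD m n (A B : 'M[C]_(m, n)) : (A + B)^t* = A^t* + B^t*.
Proof. by rewrite linearD /= map_mxD. Qed.

Lemma adjmxN m n (A : 'M[C]_(m, n)) : (- A)^t* = - A^t*.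
Proof. by rewrite linearN /= map_mxN. Qed.

Lemma adjmxE m n (A : 'M[C]_(m, n)) i j : A^t* i j = (A j i)^*%R.
Proof. by rewrite !mxE. Qed.

Lemma complexReD (x y : C) : complex.Re (x + y) = complex.Re x + complex.Re y.
Proof. by case: x y => [? ?] [? ?]. Qed.

Lemma complexReN (x : C) : complex.Re (- x) = - complex.Re x.
Proof. by case: x. Qed.

Lemma complexReMl (a : R) (x : C) : complex.Re (a%:C * x) = a * complex.Re x.
Proof. by case: x => [? ?] /=; rewrite mul0r subr0. Qed.

Lemma complexReJ (x : C) : complex.Re x^*%R = complex.Re x.
Proof. by case: x. Qed.

Lemma complexRe_sum I (r : seq I) (P : pred I) (F : I -> C) :
  complex.Re (\sum_(i <- r | P i) F i) = \sum_(i <- r | P i) complex.Re (F i).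
Proof. exact: (big_morph _ complexReD). Qed.

Lemma conj_real_complex (a : R) : (a%:C)^*%R = a%:C.
Proof. exact: conjc_real. Qed.

(** [retr (A^t* *m B)] is the real Frobenius inner product; working with it keeps all inequalities
    in [R]. *)
Definition retr n (M : 'M[C]_n) : R := complex.Re (\tr M).

Lemma retrD n (M N : 'M[C]_n) : retr (M + N) = retr M + retr N.
Proof. by rewrite /retr linearD /= complexReD. Qed.

Lemma retrN n (M : 'M[C]_n) : retr (- M) = - retr M.
Proof. by rewrite /retr linearN /= complexReN. Qed.

Lemma retrB n (M N : 'M[C]_n) : retr (M - N) = retr M - retr N.
Proof. by rewrite retrD retrN. Qed.

Lemma retrC m n (A : 'M[C]_(m, n)) (B : 'M[C]_(n, m)) :
  retr (A *m B) = retr (B *m A).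
Proof. by rewrite /retr mxtrace_mulC. Qed.

Lemma retrJ n (M : 'M[C]_n) : retr (M^t*) = retr M.
Proof.
rewrite /retr /mxtrace !complexRe_sum; apply: eq_bigr => i _.
by rewrite adjmxE complexReJ.
Qed.

Definition sqmod (z : C) : R := complex.Re z ^+ 2 + complex.Im z ^+ 2.

Lemma sqmod_ge0 z : 0 <= sqmod z.
Proof. by rewrite addr_ge0 ?sqr_ge0. Qed.

Lemma Re_conjM (z : C) : complex.Re (z^*%R * z) = sqmod z.
Proof. by case: z => a b; rewrite /sqmod /= !expr2 mulNr opprK. Qed.

Lemma sqmodMl (a : R) z : sqmod (a%:C * z) = a ^+ 2 * sqmod z.
Proof. by case: z => b c; rewrite /sqmod /=; ring. Qed.

(** The squared Frobenius norm. *)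
Definition nrm2 m n (M : 'M[C]_(m, n)) : R := retr (M^t* *m M).

Lemma nrm2E m n (M : 'M[C]_(m, n)) : nrm2 M = \sum_i \sum_j sqmod (M i j).
Proof.
rewrite /nrm2 /retr /mxtrace complexRe_sum exchange_big /=; apply: eq_bigr => j _.
rewrite mxE complexRe_sum; apply: eq_bigr => i _.
by rewrite adjmxE Re_conjM.
Qed.

Lemma nrm2_ge0 m n (M : 'M[C]_(m, n)) : 0 <= nrm2 M.
Proof. by rewrite nrm2E; do 2 apply: sumr_ge0 => ? _; exact: sqmod_ge0. Qed.

Lemma nrm2_eq0 m n (M : 'M[C]_(m, n)) : nrm2 M = 0 -> M = 0.
Proof.
rewrite nrm2E => /eqP; rewrite psumr_eq0; last first.
  by move=> i _; apply: sumr_ge0 => j _; exact: sqmod_ge0.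
move=> /allP M0; apply/matrixP => i j; rewrite [RHS]mxE.
have := M0 i (mem_index_enum i); rewrite /= psumr_eq0; last first.
  by move=> l _; exact: sqmod_ge0.
move=> /allP /(_ j (mem_index_enum j)) /=.
rewrite /sqmod paddr_eq0 ?sqr_ge0 // !sqrf_eq0.
by case: (M i j) => a b /= /andP[/eqP -> /eqP ->].
Qed.

Lemma nrm2N m n (M : 'M[C]_(m, n)) : nrm2 (- M) = nrm2 M.
Proof. by rewrite /nrm2 adjmxN mulNmx mulmxN opprK. Qed.

Lemma nrm2B m n (A B : 'M[C]_(m, n)) :
  nrm2 (A - B) = nrm2 A + nrm2 B - 2 * retr (A^t* *m B).
Proof.
have BA : retr (B^t* *m A) = retr (A^t* *m B) by rewrite -retrJ adjmxM trmxCK.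
rewrite /nrm2 adjmxB mulmxBr.
rewrite [X in X - _]mulmxBl [X in _ - X]mulmxBl [LHS]retrB.
rewrite [X in X - _]retrB [X in _ - X]retrB.
rewrite BA; move: (retr _) (retr _) (retr _) => a b c; lra.
Qed.

(** Cauchy-Schwarz in its arithmetic-mean form, read off from [0 <= nrm2 (A - B)]. *)
Lemma retr_le_nrm2 m n (A B : 'M[C]_(m, n)) :
  2 * retr (A^t* *m B) <= nrm2 A + nrm2 B.
Proof. by rewrite -subr_ge0 -nrm2B nrm2_ge0. Qed.

(** Operator norm at most one, tested on matrices with any number of columns so that it applies
    directly to products. *)
Definition contraction m n (M : 'M[C]_(m, n)) : Prop :=
  forall p (x : 'M[C]_(n, p)), nrm2 (M *m x) <= nrm2 x.

Lemma contractionM m n p (A : 'M[C]_(m, n)) (B : 'M[C]_(n, p)) :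
  contraction A -> contraction B -> contraction (A *m B).
Proof. by move=> cA cB q x; rewrite -mulmxA (le_trans (cA _ _)). Qed.

(** With [y = A^t* *m x], the inner product of [x] and [A *m y] is [nrm2 y], so [2 nrm2 y <= nrm2 x
    + nrm2 (A *m y) <= nrm2 x + nrm2 y]. *)
Lemma contractionJ m n (A : 'M[C]_(m, n)) : contraction A -> contraction (A^t*).
Proof.
move=> cA p x; have := retr_le_nrm2 x (A *m (A^t* *m x)).
have := cA p (A^t* *m x).
have -> : retr (x^t* *m (A *m (A^t* *m x))) = nrm2 (A^t* *m x).
  by rewrite /nrm2 adjmxM trmxCK !mulmxA.
lra.
Qed.

Lemma contractionN m n (A : 'M[C]_(m, n)) : contraction A -> contraction (- A).
Proof. by move=> cA p x; rewrite mulNmx nrm2N. Qed.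

Lemma isometry_nrm2 m n p (A : 'M[C]_(m, n)) (x : 'M[C]_(n, p)) :
  A^t* *m A = 1%:M -> nrm2 (A *m x) = nrm2 x.
Proof.
by move=> AA; rewrite /nrm2 adjmxM -mulmxA (mulmxA _ A) AA mul1mx.
Qed.

Lemma nrm2_gram m1 m2 n p (A : 'M[C]_(m1, n)) (B : 'M[C]_(m2, n))
    (x : 'M[C]_(n, p)) :
  A^t* *m A = B^t* *m B -> nrm2 (A *m x) = nrm2 (B *m x).
Proof.
by move=> AB; rewrite /nrm2 !adjmxM -2!mulmxA (mulmxA _ A) (mulmxA _ B) AB.
Qed.

Lemma isometry_contraction m n (A : 'M[C]_(m, n)) :
  A^t* *m A = 1%:M -> contraction A.
Proof. by move=> AA p x; rewrite isometry_nrm2. Qed.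

Definition rdiag n (s : 'I_n -> R) : 'M[C]_n := diag_mx (\row_i (s i)%:C).

Lemma rdiagE n (s : 'I_n -> R) i j : rdiag s i j = ((s i)%:C *+ (i == j)).
Proof. by rewrite !mxE. Qed.

Lemma mul_rdiag_mx n p (s : 'I_n -> R) (x : 'M[C]_(n, p)) i j :
  (rdiag s *m x) i j = (s i)%:C * x i j.
Proof. by rewrite mul_diag_mx !mxE. Qed.

Lemma mul_mx_rdiag n p (s : 'I_n -> R) (x : 'M[C]_(p, n)) i j :
  (x *m rdiag s) i j = x i j * (s j)%:C.
Proof. by rewrite mul_mx_diag !mxE. Qed.

Lemma rdiagJ n (s : 'I_n -> R) : (rdiag s)^t* = rdiag s.
Proof.
apply/matrixP => i j; rewrite adjmxE !rdiagE eq_sym.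
by case: eqP => [->|_]; rewrite ?mulr1n ?mulr0n ?conj_real_complex // conjC0.
Qed.

Lemma rdiagM n (s t : 'I_n -> R) :
  rdiag s *m rdiag t = rdiag (fun i => s i * t i).
Proof.
apply/matrixP => i j; rewrite mul_rdiag_mx !rdiagE rmorphM /= mulrnAr.
by case: eqP => [->|].
Qed.

Lemma eq_rdiag n (s t : 'I_n -> R) : s =1 t -> rdiag s = rdiag t.
Proof. by move=> st; apply/matrixP => i j; rewrite !rdiagE st. Qed.

Lemma rdiag1 n : rdiag (fun _ : 'I_n => 1) = 1%:M.
Proof. by apply/matrixP => i j; rewrite rdiagE mxE. Qed.

Lemma rdiagB n (s t : 'I_n -> R) :
  rdiag s - rdiag t = rdiag (fun i => s i - t i).
Proof.
by apply/matrixP => i j; rewrite !mxE rmorphB mulrnBl.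
Qed.

Lemma retr_rdiagM n (s : 'I_n -> R) (N : 'M[C]_n) :
  retr (rdiag s *m N) = \sum_i s i * complex.Re (N i i).
Proof.
rewrite /retr /mxtrace complexRe_sum; apply: eq_bigr => i _.
by rewrite mul_rdiag_mx complexReMl.
Qed.

Lemma retr_rdiag n (s : 'I_n -> R) : retr (rdiag s) = \sum_i s i.
Proof.
rewrite -[rdiag s]mulmx1 retr_rdiagM; apply: eq_bigr => i _.
by rewrite mxE eqxx mulr1.
Qed.

Lemma nrm2_rdiagM n p (s : 'I_n -> R) (x : 'M[C]_(n, p)) :
  nrm2 (rdiag s *m x) = \sum_i s i ^+ 2 * \sum_j sqmod (x i j).
Proof.
rewrite nrm2E; apply: eq_bigr => i _; rewrite mulr_sumr; apply: eq_bigr => j _.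
by rewrite mul_rdiag_mx sqmodMl.
Qed.

Lemma nrm2_rdiag n (s : 'I_n -> R) : nrm2 (rdiag s) = \sum_i s i ^+ 2.
Proof. by rewrite /nrm2 rdiagJ rdiagM retr_rdiag. Qed.

Lemma rdiag_contraction n (s : 'I_n -> R) :
  (forall i, s i ^+ 2 <= 1) -> contraction (rdiag s).
Proof.
move=> s1 p x; rewrite nrm2_rdiagM nrm2E; apply: ler_sum => i _.
by rewrite ler_piMl // sumr_ge0 // => j _; exact: sqmod_ge0.
Qed.

Lemma unitary_comm n (V : 'M[C]_n) : V^t* *m V = 1%:M -> V *m V^t* = 1%:M.
Proof. exact: mulmx1C. Qed.

Lemma unitary_adj n (V : 'M[C]_n) :
  V^t* *m V = 1%:M -> (V^t*)^t* *m V^t* = 1%:M.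
Proof. by move=> VV; rewrite trmxCK; exact: unitary_comm. Qed.

End RealPartTrace.

(** * Abel summation and Horn's product inequality *)

Section WeakProduct.
Context {R : realType}.
Local Notation C := R[i].

(** By induction, a weighted sum up to [m] is at least [s m] times the plain one: lowering the
    weight from [s m] to [s m.+1] can only decrease a nonnegative partial sum. *)
Lemma abel_ge0 (n : nat) (s x : nat -> R) :
  (forall i j, (i <= j < n)%N -> s j <= s i) ->
  (forall i, (i < n)%N -> 0 <= s i) ->
  (forall p, (p <= n)%N -> 0 <= \sum_(l < p) x l) ->
  0 <= \sum_(l < n) s l * x l.
Proof.
move=> s_dec s_ge0 x_ge0; case: n => [|n] in s_dec s_ge0 x_ge0 *.
  by rewrite big_ord0.
suff H m : (m <= n)%N -> s m * \sum_(l < m.+1) x l <= \sum_(l < m.+1) s l * x l.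
  by apply: le_trans (H n (leqnn n)); rewrite mulr_ge0 ?s_ge0 ?x_ge0.
elim: m => [|m IH] mn; first by rewrite !big_ord1.
rewrite big_ord_recr [leRHS]big_ord_recr /= mulrDr lerD2r.
apply: le_trans (IH (ltnW mn)); rewrite ler_wpM2r ?x_ge0 //; first exact: ltnW.
by rewrite s_dec ?leqnSn.
Qed.

Lemma abel_le (n : nat) (s t u : nat -> R) :
  (forall i j, (i <= j < n)%N -> s j <= s i) ->
  (forall i, (i < n)%N -> 0 <= s i) ->
  (forall p, (p <= n)%N -> \sum_(l < p) t l <= \sum_(l < p) u l) ->
  \sum_(l < n) s l * t l <= \sum_(l < n) s l * u l.
Proof.
move=> s_dec s_ge0 tu; rewrite -subr_ge0 -sumrB.
under eq_bigr do rewrite -mulrBr.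
apply: (@abel_ge0 n s (fun l => u l - t l)) => // p pn.
by rewrite sumrB subr_ge0 tu.
Qed.

(** [kyfan_bounded] sums its bound over [l < m] for arbitrary [m], so vectors are extended by zero
    to all of [nat]. *)
Definition zero_ext k (s : 'I_k -> R) (l : nat) : R := oapp s 0 (insub l).

Lemma zero_extE k (s : 'I_k -> R) (i : 'I_k) : zero_ext s i = s i.
Proof. by rewrite /zero_ext valK. Qed.

Lemma zero_ext_out k (s : 'I_k -> R) l : (k <= l)%N -> zero_ext s l = 0.
Proof. by rewrite leqNgt => lk; rewrite /zero_ext insubF //; apply/negbTE. Qed.

Definition antitone k (s : 'I_k -> R) := forall i j : 'I_k, (i <= j)%N -> s j <= s i.

Lemma antitoneM k (s t : 'I_k -> R) :
  antitone s -> antitone t -> (forall i, 0 <= s i) -> (forall i, 0 <= t i) ->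
  antitone (fun i => s i * t i).
Proof. by move=> s_dec t_dec s0 t0 i j ij; rewrite ler_pM ?s_dec ?t_dec. Qed.

Lemma antitoneD k (s t : 'I_k -> R) :
  antitone s -> antitone t -> antitone (fun i => s i + t i).
Proof. by move=> s_dec t_dec i j ij; rewrite lerD ?s_dec ?t_dec. Qed.

Lemma antitone_rev_inv k (s : 'I_k -> R) :
  antitone s -> (forall i, 0 < s i) -> antitone (fun i => (s (rev_ord i))^-1).
Proof.
move=> s_dec s0 i j ij; rewrite lef_pV2 ?posrE ?s0 //.
by apply: s_dec; rewrite /= leq_sub2l.
Qed.

Lemma antitone_sines k (s : 'I_k -> R) :
  antitone s -> (forall i, 0 <= s i) ->
  antitone (fun i => Num.sqrt (1 - s (rev_ord i) ^+ 2)).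
Proof.
move=> s_dec s0 i j ij; rewrite ler_wsqrtr // lerB // lerXn2r ?nnegrE //.
by apply: s_dec; rewrite /= leq_sub2l.
Qed.

Lemma zero_ext_antitone k (s : 'I_k -> R) i j :
  antitone s -> (i <= j < k)%N -> zero_ext s j <= zero_ext s i.
Proof.
move=> s_dec /andP[ij jk].
have ik := leq_ltn_trans ij jk.
by have := s_dec (Ordinal ik) (Ordinal jk) ij; rewrite -!zero_extE.
Qed.

Lemma zero_ext_ge0 k (s : 'I_k -> R) l : (forall i, 0 <= s i) -> 0 <= zero_ext s l.
Proof. by move=> s0; rewrite /zero_ext; case: (insub l) => /=. Qed.

Lemma zero_extM k (s t : 'I_k -> R) l :
  zero_ext (fun i => s i * t i) l = zero_ext s l * zero_ext t l.
Proof. by rewrite /zero_ext; case: (insub l) => //=; rewrite mul0r. Qed.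

Lemma sum_zero_ext k (s : 'I_k -> R) m :
  \sum_(l < m) zero_ext s l = \sum_(i < k | (i < m)%N) s i.
Proof.
have [km|mk] := leqP k m.
  rewrite -(big_mkord predT) (big_cat_nat (n := k)) //= [X in _ + X]big_nat_cond.
  rewrite [X in _ + X]big1 ?addr0 => [|i]; last first.
    by rewrite andbT => /andP[ki _]; rewrite zero_ext_out.
  rewrite big_mkord; apply: eq_big => i.
    by rewrite (leq_trans (ltn_ord i) km).
  by rewrite zero_extE.
rewrite (big_ord_widen _ _ (ltnW mk)); apply: eq_bigr => i _.
by rewrite zero_extE.
Qed.

(* The trace bounds that make Ky Fan's maximum principle and Horn's product
   inequality both follow by Abel summation: testing against pairs of
   contractions with squared Frobenius norm at most m replaces testing against
   partial isometries of rank m. *)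
Definition kyfan_bounded d k (M : 'M[C]_(d, k)) (a : nat -> R) : Prop :=
  forall n (U : 'M[C]_(d, n)) (W : 'M[C]_(k, n)) (m : nat),
    contraction U -> contraction W -> nrm2 U <= m%:R -> nrm2 W <= m%:R ->
    retr (U^t* *m M *m W) <= \sum_(l < m) a l.

Lemma kyfan_boundedJ d k (M : 'M[C]_(d, k)) a :
  kyfan_bounded M a -> kyfan_bounded (M^t*) a.
Proof.
move=> Ma n U W m cU cW U_m W_m.
by rewrite -retrJ !adjmxM !trmxCK mulmxA Ma.
Qed.

Lemma kyfan_boundedN d k (M : 'M[C]_(d, k)) a :
  kyfan_bounded M a -> kyfan_bounded (- M) a.
Proof.
move=> Ma n U W m cU cW U_m W_m.
have := Ma n (- U) W m (contractionN cU) cW.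
by rewrite nrm2N adjmxN mulNmx -mulmxN => /(_ U_m W_m).
Qed.

Lemma kyfan_boundedD d k (M N : 'M[C]_(d, k)) a b :
  kyfan_bounded M a -> kyfan_bounded N b ->
  kyfan_bounded (M + N) (fun l => a l + b l).
Proof.
move=> Ma Nb n U W m cU cW U_m W_m.
by rewrite mulmxDr mulmxDl retrD big_split /= lerD ?Ma ?Nb.
Qed.

Lemma contraction_nrm2_le m n p (A : 'M[C]_(m, n)) (x : 'M[C]_(n, p)) (b : R) :
  contraction A -> nrm2 x <= b -> nrm2 (A *m x) <= b.
Proof. by move=> cA; apply: le_trans; exact: cA. Qed.

(** The contraction is absorbed into the test matrix [U], which stays a contraction of no larger
    norm. *)
Lemma kyfan_bounded_mull d k e (N : 'M[C]_(d, e)) (M : 'M[C]_(d, k)) a :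
  contraction N -> kyfan_bounded M a -> kyfan_bounded (N^t* *m M) a.
Proof.
move=> cN Ma n U W m cU cW U_m W_m; rewrite mulmxA -adjmxM.
by apply: Ma => //; [exact: contractionM | exact: contraction_nrm2_le].
Qed.

Lemma kyfan_bounded_mulr d k e (N : 'M[C]_(k, e)) (M : 'M[C]_(d, k)) a :
  contraction N -> kyfan_bounded M a -> kyfan_bounded (M *m N) a.
Proof.
move=> cN Ma n U W m cU cW U_m W_m; rewrite mulmxA -mulmxA.
by apply: Ma => //; [exact: contractionM | exact: contraction_nrm2_le].
Qed.

Lemma kyfan_bounded1 d : kyfan_bounded (1%:M : 'M[C]_d) (fun=> 1).
Proof.
move=> n U W m _ _ U_m W_m; rewrite mulmx1 sumr_const card_ord.
have := retr_le_nrm2 U W; lra.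
Qed.

Section Horn.
Variables (d k e : nat) (B F : 'M[C]_(d, k)) (V : 'M[C]_k) (s : 'I_k -> R).
Hypotheses (cF : contraction F) (V_unit : V^t* *m V = 1%:M).
Hypotheses (B_svd : B = F *m rdiag s *m V^t*).
Hypotheses (s_dec : antitone s) (s_ge0 : forall i, 0 <= s i).

Let cutoff p : 'M[C]_k := rdiag (fun i => ((i < p)%N)%:R).

Let cutoff_contraction p : contraction (cutoff p).
Proof. by apply: rdiag_contraction => i; case: ltnP; rewrite ?expr1n ?expr0n. Qed.

Let cutoff_idem p : cutoff p *m cutoff p = cutoff p.
Proof. by rewrite rdiagM; apply: eq_rdiag => i; rewrite -natrM mulnb andbb. Qed.

Let nrm2_cutoff p : nrm2 (cutoff p) <= p%:R.
Proof.
rewrite nrm2_rdiag (eq_bigr (fun i : 'I_k => if (i < p)%N then 1 else 0)); last first.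
  by move=> i _; case: ltnP; rewrite ?expr1n ?expr0n.
rewrite -big_mkcond -(sum_zero_ext (fun=> 1)) -[p in p%:R]card_ord -sumr_const.
by apply: ler_sum => l _; rewrite /zero_ext; case: (insub _) => /=.
Qed.

(** By cyclicity the trace is a sum of [s i * Re (N i i)]. Abel summation reduces the claim to
    partial sums over [i < p], which are traces of [M] against new test pairs and so are bounded by
    the first [min(p, m)] values of [a]. *)
Lemma kyfan_bounded_horn (M : 'M[C]_(d, e)) (a : nat -> R) :
  kyfan_bounded M a ->
  kyfan_bounded (B^t* *m M) (fun l => zero_ext s l * a l).
Proof.
move=> Ma n U W m cU cW U_m W_m.
set N := F^t* *m M *m W *m U^t* *m V.
set t := fun i => complex.Re (N i i).
have -> : retr (U^t* *m (B^t* *m M) *m W) = retr (rdiag s *m N).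
  rewrite B_svd !adjmxM trmxCK rdiagJ /N -!mulmxA.
  by rewrite [LHS]retrC -!mulmxA [LHS]retrC -!mulmxA.
have partial p : \sum_(l < p) zero_ext t l = retr (cutoff p *m N).
  rewrite sum_zero_ext retr_rdiagM big_mkcond /=; apply: eq_bigr => i _.
  by case: ifP; rewrite ?mul1r ?mul0r.
have -> : retr (rdiag s *m N) = \sum_(l < k) zero_ext s l * zero_ext t l.
  by rewrite retr_rdiagM; apply: eq_bigr => i _; rewrite !zero_extE.
(* Truncating [a] at [m] makes the partial sum of [b] up to [p] the sum of [a] up to [min(p, m)]. *)
pose b l := if (l < m)%N then a l else 0.
have -> : \sum_(l < m) zero_ext s l * a l = \sum_(l < k) zero_ext s l * b l.
  transitivity (\sum_(l < m) zero_ext (fun i : 'I_k => s i * a i) l).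
    apply: eq_bigr => l _; have [lk|kl] := ltnP l k; last first.
      by rewrite !zero_ext_out ?mul0r.
    by rewrite -[nat_of_ord l]/(nat_of_ord (Ordinal lk)) !zero_extE.
  rewrite sum_zero_ext big_mkcond /=; apply: eq_bigr => i _.
  by rewrite zero_extE /b; case: ifP; rewrite ?mulr0.
apply: abel_le.
- by move=> i j; exact: zero_ext_antitone.
- by move=> i _; exact: zero_ext_ge0.
move=> p _; rewrite partial; have [pm|mp] := leqP p m.
  have -> : \sum_(l < p) b l = \sum_(l < p) a l.
    by apply: eq_bigr => l _; rewrite /b (leq_trans (ltn_ord l) pm).
  (* For [p <= m], idempotence places one cutoff in each test matrix, so both have squared norm at
     most [p]. *)
  have -> : retr (cutoff p *m N) =
      retr ((F *m cutoff p)^t* *m M *m (W *m U^t* *m V *m cutoff p)).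
    by rewrite adjmxM rdiagJ -{1}cutoff_idem -mulmxA [LHS]retrC /N !mulmxA.
  have cV := isometry_contraction V_unit.
  have cWUV := contractionM (contractionM cW (contractionJ cU)) cV.
  have cp := cutoff_contraction p.
  exact: (Ma _ _ _ p (contractionM cF cp) (contractionM cWUV cp)
    (contraction_nrm2_le cF (nrm2_cutoff p))
    (contraction_nrm2_le cWUV (nrm2_cutoff p))).
have -> : \sum_(l < p) b l = \sum_(l < m) a l.
  by rewrite [RHS](big_ord_widen _ _ (ltnW mp)) [RHS]big_mkcond.
(* For [m < p], the cutoff is absorbed as a contraction acting on [U], and the norm bounds by [m]
   are kept. *)
have -> : retr (cutoff p *m N) =
    retr ((F *m cutoff p *m V^t* *m U)^t* *m M *m W).
  rewrite !adjmxM trmxCK rdiagJ /N -!mulmxA.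
  by rewrite [RHS]retrC -!mulmxA [RHS]retrC -!mulmxA.
have cV := isometry_contraction V_unit.
have cFV := contractionM (contractionM cF (cutoff_contraction p)) (contractionJ cV).
exact: (Ma _ _ _ m (contractionM cFV cU) cW (contraction_nrm2_le cFV U_m) W_m).
Qed.

End Horn.

End WeakProduct.

(** * Sorted spectra and singular values *)

Section SortedSpectrum.
Context {R : realType}.
Local Notation C := R[i].

Local Lemma geR_trans : transitive (>=%R : rel R).
Proof. by move=> x y z xy yz; exact: le_trans yz xy. Qed.

Local Lemma geR_total : total (>=%R : rel R).
Proof. by move=> x y; exact: le_total. Qed.

Local Lemma geR_anti : antisymmetric (>=%R : rel R).
Proof. by move=> x y; rewrite andbC; exact: le_anti. Qed.

Lemma nth_codom_ord n (s : 'I_n -> R) (i : 'I_n) : [seq s l | l : 'I_n]`_i = s i.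
Proof.
by rewrite (nth_map i) ?size_enum_ord ?ltn_ord // nth_ord_enum.
Qed.

Lemma sort_codom_perm n (s : 'I_n -> R) :
  exists2 p : 'S_n, antitone (fun i => s (p i)) &
    forall i : 'I_n, (sort >=%R [seq s l | l : 'I_n])`_i = s (p i).
Proof.
set t := [seq s l | l : 'I_n].
have t_size : size t == n by rewrite size_map size_enum_ord.
have st_t : perm_eq (sort >=%R t) (Tuple t_size) by rewrite perm_sort.
have [p ep] := tuple_permP st_t.
have nth_p (i : 'I_n) : (sort >=%R t)`_i = s (p i).
  rewrite ep (nth_map i) ?size_enum_ord ?ltn_ord // nth_ord_enum.
  by rewrite (tnth_nth 0) /= nth_codom_ord.
exists p => // i j ij; rewrite -!nth_p.
apply: (sorted_leq_nth geR_trans) => //.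
- by move=> x; exact: lexx.
- exact: (sort_sorted geR_total).
- by rewrite inE size_sort (eqP t_size).
- by rewrite inE size_sort (eqP t_size).
Qed.

Lemma sort_antitone n (s : 'I_n -> R) (t : seq R) : antitone s ->
  perm_eq t [seq s l | l : 'I_n] -> forall i : 'I_n, (sort >=%R t)`_i = s i.
Proof.
move=> s_dec ts i.
suff -> : sort >=%R t = [seq s l | l : 'I_n] by rewrite nth_codom_ord.
apply: (sorted_eq geR_trans geR_anti).
- exact: (sort_sorted geR_total).
- apply/(sortedP 0) => j; rewrite size_map size_enum_ord => jn.
  have jn' := ltnW jn.
  have -> : [seq s l | l : 'I_n]`_j = s (Ordinal jn') by rewrite -nth_codom_ord.
  have -> : [seq s l | l : 'I_n]`_j.+1 = s (Ordinal jn) by rewrite -nth_codom_ord.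
  exact: s_dec.
- by rewrite perm_sort.
Qed.

Lemma char_poly_conj n (V W N : 'M[C]_n) : W *m V = 1%:M ->
  char_poly (V *m N *m W) = char_poly N.
Proof.
move=> WV; have VW := mulmx1C WV; rewrite /char_poly.
have -> : char_poly_mx (V *m N *m W) =
    map_mx polyC V *m char_poly_mx N *m map_mx polyC W.
  rewrite /char_poly_mx !map_mxM mulmxBr mulmxBl; congr (_ - _).
  by rewrite scalar_mxC -mulmxA -map_mxM VW map_mx1 mulmx1.
by rewrite !det_mulmx mulrAC -det_mulmx -map_mxM VW map_mx1 det1 mul1r.
Qed.

(** Both lists are the roots, with multiplicity, of the same characteristic polynomial, hence
    permutations of each other; sorting then gives back the antitone [s]. *)
Lemma eigvals_unique n (M V : 'M[C]_n) (s : 'I_n -> R) :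
  V^t* *m V = 1%:M -> M = V *m rdiag s *m V^t* -> antitone s ->
  forall i, eigvals M 0 i = s i.
Proof.
move=> VV ME s_dec i; rewrite mxE.
apply: sort_antitone => //.
suff /(perm_map (@complex.Re R)) :
    perm_eq (eigenvalue_seq M) [seq (s l)%:C | l : 'I_n].
  by rewrite -map_comp.
apply: prod_XsubC_eq.
have := svalP (closed_field_poly_normal (char_poly M)).
rewrite -/(eigenvalue_seq M) (monicP (char_poly_monic M)) scale1r => <-.
rewrite ME char_poly_conj // char_poly_trig; last exact/diag_mx_is_trig.
by rewrite big_map big_enum; apply: eq_bigr => l _; rewrite rdiagE eqxx.
Qed.

Lemma diag_col_perm n (V : 'M[C]_n) (d : 'I_n -> R) (p : 'S_n) :
  V *m rdiag d *m V^t* =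
  col_perm p V *m rdiag (fun i => d (p i)) *m (col_perm p V)^t*.
Proof.
apply/matrixP => i j; rewrite mxE [RHS]mxE.
rewrite [LHS](reindex_inj (@perm_inj _ p)); apply: eq_bigr => l _.
by rewrite !mul_mx_rdiag !mxE.
Qed.

Lemma col_perm_unitary n (V : 'M[C]_n) (p : 'S_n) :
  V^t* *m V = 1%:M -> (col_perm p V)^t* *m col_perm p V = 1%:M.
Proof.
move=> VV; transitivity (\matrix_(i, j) (V^t* *m V) (p i) (p j)).
  by apply/matrixP => i j; rewrite !mxE; apply: eq_bigr => l _; rewrite !mxE.
by rewrite VV; apply/matrixP => i j; rewrite !mxE (inj_eq perm_inj).
Qed.

(** Sorts an arbitrary unitary diagonalisation by permuting eigenvectors. The permutation stays
    visible so that the same one can be applied to functions of [d]. *)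
Lemma eigvals_perm n (M V : 'M[C]_n) (d : 'I_n -> R) :
  V^t* *m V = 1%:M -> M = V *m rdiag d *m V^t* ->
  exists p : 'S_n,
    [/\ (col_perm p V)^t* *m col_perm p V = 1%:M,
        M = col_perm p V *m rdiag (fun i => eigvals M 0 i) *m (col_perm p V)^t*,
        antitone (fun i => eigvals M 0 i) &
        forall i, eigvals M 0 i = d (p i)].
Proof.
move=> VV ME; have [p p_dec _] := sort_codom_perm d.
have VpU := col_perm_unitary p VV.
have MVp : M = _ := etrans ME (diag_col_perm V d p).
have eig := eigvals_unique VpU MVp p_dec.
exists p; split; last exact: eig.
- exact: VpU.
- by rewrite (eq_rdiag eig).
- by move=> i j ij; rewrite !eig; exact: p_dec.
Qed.

Lemma spectral_theorem n (M : 'M[C]_n) : M^t* = M ->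
  exists V : 'M[C]_n,
    [/\ V^t* *m V = 1%:M, M = V *m rdiag (fun i => eigvals M 0 i) *m V^t* &
        antitone (fun i => eigvals M 0 i)].
Proof.
move=> MJ.
have Mherm : M \is hermsymmx by apply/is_hermitianmxP; rewrite expr0 scale1r MJ.
have /orthomx_spectralP := hermitian_normalmx Mherm.
have := hermitian_spectral_diag_real Mherm.
set D := spectral_diag M; set P := spectralmx M => Dreal ME.
have PU : P \is unitarymx := spectral_unitarymx M.
have PP : P *m P^t* = 1%:M by apply/unitarymxP.
rewrite (invmx_unitary PU) in ME.
have dE : diag_mx D = rdiag (fun i => complex.Re (D 0 i)).
  congr diag_mx; apply/rowP => i; rewrite mxE RRe_real //.
  exact: (mxOverP Dreal).
have [||p [VU MV dec _]] := @eigvals_perm _ M (P^t*) (fun i => complex.Re (D 0 i)).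
- by rewrite trmxCK.
- by rewrite trmxCK -dE.
- by exists (col_perm p (P^t*)).
Qed.

(** * Singular values and singular value decomposition *)

Section SingularValues.
Variables (d k : nat) (B : 'M[C]_(d, k)).
Local Notation s := (fun i => singvals B 0 i).

(** [psd_sqrt] uses the same eigenvectors as the Gram matrix, with square roots as eigenvalues; the
    permutation that sorts the roots sorts their squares as well. *)
Lemma gram_singvals :
  exists V : 'M[C]_k,
    [/\ V^t* *m V = 1%:M, B^t* *m B = V *m rdiag (fun i => s i ^+ 2) *m V^t*,
        antitone s & forall i, 0 <= s i].
Proof.
set H := B^t* *m B.
have HJ : H^t* = H by rewrite adjmxM trmxCK.
have Hherm : H \is hermsymmx by apply/is_hermitianmxP; rewrite expr0 scale1r HJ.
have /orthomx_spectralP := hermitian_normalmx Hherm.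
set D := spectral_diag H; set P := spectralmx H => HE.
have PU : P \is unitarymx := spectral_unitarymx H.
have PP : P *m P^t* = 1%:M by apply/unitarymxP.
rewrite (invmx_unitary PU) in HE.
(* The diagonal form is itself a Gram matrix, so its diagonal entries are sums of squared moduli. *)
have DE : diag_mx D = (B *m P^t*)^t* *m (B *m P^t*).
  rewrite adjmxM trmxCK -mulmxA (mulmxA _ B) -/H HE !mulmxA PP mul1mx.
  by rewrite -mulmxA PP mulmx1.
have D_ge0 i : 0 <= D 0 i.
  have -> : D 0 i = diag_mx D i i by rewrite mxE eqxx.
  rewrite DE mxE sumr_ge0 // => l _; rewrite adjmxE mulrC.
  by rewrite -normCK exprn_ge0.
pose r i := complex.Re (sqrtC (D 0 i)).
have rE i : (r i)%:C = sqrtC (D 0 i).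
  by rewrite RRe_real // ger0_real // sqrtC_ge0.
have r_ge0 i : 0 <= r i by rewrite -ler0c rE sqrtC_ge0.
have D_r : diag_mx D = rdiag (fun i => r i ^+ 2).
  congr diag_mx; apply/rowP => i.
  by rewrite [RHS]mxE rmorphXn /= rE sqrtCK.
have sqrtE : psd_sqrt H = P^t* *m rdiag r *m (P^t*)^t*.
  rewrite /psd_sqrt (invmx_unitary PU) trmxCK -/D.
  have -> : map_mx sqrtC D = \row_i (r i)%:C.
    by apply/rowP => i; rewrite !mxE rE.
  by [].
have [|p [VU _ dec eig]] := eigvals_perm _ sqrtE; first by rewrite trmxCK.
exists (col_perm p (P^t*)); split; last by move=> i; rewrite /singvals eig.
- by apply: col_perm_unitary; rewrite trmxCK.
- rewrite (eq_rdiag (t := fun i => r (p i) ^+ 2)); last first.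
    by move=> i; rewrite /singvals eig.
  by rewrite -(diag_col_perm _ (fun i => r i ^+ 2)) trmxCK -D_r.
- exact: dec.
Qed.

Lemma singvals_ge0 i : 0 <= s i.
Proof. by have [? []] := gram_singvals. Qed.

Lemma singvals_antitone : antitone s.
Proof. by have [? []] := gram_singvals. Qed.

(** The squares of both families are the sorted eigenvalues of the Gram matrix, and squaring is
    injective on nonnegative reals. *)
Lemma singvals_unique (V : 'M[C]_k) (t : 'I_k -> R) :
  V^t* *m V = 1%:M -> B^t* *m B = V *m rdiag (fun i => t i ^+ 2) *m V^t* ->
  antitone t -> (forall i, 0 <= t i) -> forall i, s i = t i.
Proof.
move=> VV BB t_dec t_ge0 i; have [W [WW BBW s_dec s_ge0]] := gram_singvals.
have sq_dec (u : 'I_k -> R) : antitone u -> (forall i, 0 <= u i) ->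
    antitone (fun i => u i ^+ 2).
  by move=> u_dec u_ge0 j l jl; rewrite lerXn2r ?nnegrE ?u_ge0 ?u_dec.
have eig_t := eigvals_unique VV BB (sq_dec _ t_dec t_ge0) i.
have eig_s := eigvals_unique WW BBW (sq_dec _ s_dec s_ge0) i.
apply/eqP; rewrite -(@eqrXn2 _ 2) //; apply/eqP.
by rewrite -eig_t -eig_s.
Qed.

(** Take [V] from the Gram matrix and [F = B V S^-1]. Since [0^-1 = 0], [F] has a zero column for
    each vanishing singular value; it is an isometry as soon as all singular values are positive. *)
Lemma singvals_svd :
  exists F : 'M[C]_(d, k), exists V : 'M[C]_k,
    [/\ F^t* *m F = rdiag (fun i => (s i != 0)%:R), contraction F,
        V^t* *m V = 1%:M & B = F *m rdiag s *m V^t*].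
Proof.
have [V [VV BB s_dec s_ge0]] := gram_singvals.
pose q i : R := (s i != 0)%:R.
have qq i : q i * q i = q i by rewrite /q; case: eqP; rewrite ?mulr1 ?mulr0.
pose F := B *m V *m rdiag (fun i => (s i)^-1).
have BVBV : (B *m V)^t* *m (B *m V) = rdiag (fun i => s i ^+ 2).
  rewrite adjmxM -mulmxA (mulmxA _ B) BB !mulmxA VV mul1mx.
  by rewrite -mulmxA VV mulmx1.
have FF : F^t* *m F = rdiag q.
  rewrite /F adjmxM rdiagJ -mulmxA (mulmxA _ (B *m V)) BVBV !rdiagM.
  apply: eq_rdiag => i; rewrite /q; case: eqP => [->|/eqP s0].
    by rewrite invr0 mul0r.
  by rewrite expr2 mulfK // mulVf.
exists F, V; split => //.
- move=> p x; rewrite (@nrm2_gram _ _ _ _ _ F (rdiag q)); last first.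
    by rewrite FF rdiagJ rdiagM (eq_rdiag qq).
  apply: rdiag_contraction => i.
  by rewrite expr2 qq /q; case: eqP.
- rewrite /F -(mulmxA (B *m V)) rdiagM.
  have -> : rdiag (fun i => (s i)^-1 * s i) = rdiag q.
    apply: eq_rdiag => i; rewrite /q; case: eqP => [->|/eqP s0].
      by rewrite mulr0.
    by rewrite mulVf.
  (* Column [i] of [B *m V] has squared norm [s i ^+ 2], so the columns that [q] erases are already
     zero. *)
  suff -> : B *m V *m rdiag q = B *m V by rewrite -mulmxA unitary_comm ?mulmx1.
  apply/eqP; rewrite -subr_eq0; apply/eqP/nrm2_eq0.
  have -> : B *m V *m rdiag q - B *m V = B *m V *m rdiag (fun i => q i - 1).
    by rewrite -[B *m V in X in _ - X]mulmx1 -mulmxBr -rdiag1 rdiagB.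
  rewrite /nrm2 adjmxM rdiagJ -mulmxA (mulmxA _ (B *m V)) BVBV !rdiagM.
  rewrite retr_rdiag big1 // => i _; rewrite /q; case: eqP => [->|_].
    by rewrite expr0n mul0r mulr0.
  by rewrite subrr mul0r.
Qed.

Lemma kyfan_bounded_horn_singvals e (M : 'M[C]_(d, e)) (a : nat -> R) :
  kyfan_bounded M a ->
  kyfan_bounded (B^t* *m M) (fun l => zero_ext s l * a l).
Proof.
have [F [V [_ cF VV BE]]] := singvals_svd.
exact: (kyfan_bounded_horn cF VV BE singvals_antitone singvals_ge0).
Qed.

(** The upper bound in Ky Fan's maximum principle: Horn's inequality against the identity, bounded
    by the constant one, followed by an adjoint. *)
Lemma kyfan_bounded_singvals : kyfan_bounded B (zero_ext s).
Proof.
have H := kyfan_bounded_horn_singvals (@kyfan_bounded1 R d).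
have s1 : (fun l => zero_ext s l * 1) = zero_ext s.
  by apply/funext => l; rewrite mulr1.
rewrite s1 mulmx1 in H.
by have := kyfan_boundedJ H; rewrite trmxCK.
Qed.

End SingularValues.

End SortedSpectrum.

(** * Weyl, Lidskii and Mirsky *)

Section LidskiiMirsky.
Context {R : realType}.
Local Notation C := R[i].

Lemma retr_quad m n p (V : 'M[C]_(m, n)) (s : 'I_n -> R) (x : 'M[C]_(m, p)) :
  retr (x^t* *m (V *m rdiag s *m V^t*) *m x) =
  \sum_i s i * \sum_j sqmod ((V^t* *m x) i j).
Proof.
have -> : x^t* *m (V *m rdiag s *m V^t*) *m x =
    (V^t* *m x)^t* *m (rdiag s *m (V^t* *m x)).
  by rewrite adjmxM trmxCK !mulmxA.
rewrite [LHS]retrC -mulmxA retr_rdiagM; apply: eq_bigr => i _; congr (_ * _).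
rewrite mxE complexRe_sum; apply: eq_bigr => j _.
by rewrite adjmxE mulrC Re_conjM.
Qed.

Lemma quad_le m n p (V : 'M[C]_(m, n)) (s t : 'I_n -> R) (x : 'M[C]_(m, p)) :
  (forall i, s i <= t i) ->
  retr (x^t* *m (V *m rdiag s *m V^t*) *m x) <=
  retr (x^t* *m (V *m rdiag t *m V^t*) *m x).
Proof.
move=> st; rewrite [leLHS]retr_quad [leRHS]retr_quad; apply: ler_sum => i _.
by apply: ler_wpM2r => //; apply: sumr_ge0 => j _; exact: sqmod_ge0.
Qed.

Lemma retr_diag n (V : 'M[C]_n) (s : 'I_n -> R) :
  V^t* *m V = 1%:M -> retr (V *m rdiag s *m V^t*) = \sum_i s i.
Proof. by move=> VV; rewrite [LHS]retrC mulmxA VV mul1mx retr_rdiag. Qed.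

Lemma diag_adj n (V : 'M[C]_n) (s : 'I_n -> R) :
  (V *m rdiag s *m V^t*)^t* = V *m rdiag s *m V^t*.
Proof. by rewrite !adjmxM trmxCK rdiagJ mulmxA. Qed.

Section Weyl.
Variables (n : nat) (H K U V : 'M[C]_n) (h g : 'I_n -> R).
Hypotheses (UU : U^t* *m U = 1%:M) (VV : V^t* *m V = 1%:M).
Hypotheses (HE : H = U *m rdiag h *m U^t*) (KE : K = V *m rdiag g *m V^t*).
Hypotheses (h_dec : antitone h) (g_dec : antitone g).

(* Courant-Fischer: the span of the eigenvectors of H up to index i meets the
   span of the eigenvectors of K from index i on, because i + (n - 1 - i) < n
   linear conditions have a nonzero solution. *)
Lemma weyl_monotone (mu : R) :
  (forall x : 'cV[C]_n,
     retr (x^t* *m H *m x) + mu * nrm2 x <= retr (x^t* *m K *m x)) ->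
  forall i, h i + mu <= g i.
Proof.
move=> HK i.
have [G defG] : exists G, G = V^t* *m U by exists (V^t* *m U).
(* A row vector killed by [Z] satisfies [(G y)_m = 0] for [m < i] (column [m] is row [m] of [G]) and
   [y_m = 0] for [m > i]. Column [i] is zero, which makes [Z] singular. *)
pose Z : 'M[C]_n := \matrix_(l, m) (if (m < i)%N then G m l
                                    else ((i < m)%N && (l == m))%:R).
have Zi : \det Z = 0.
  rewrite -det_tr; apply/eqP/det0P; exists (delta_mx 0 i).
    apply/eqP => /matrixP/(_ 0 i)/eqP.
    by rewrite !mxE !eqxx oner_eq0.
  apply/rowP => l; rewrite mxE big1 ?mxE // => m _.
  rewrite !mxE eqxx /=; case: eqP => [->|_]; last by rewrite mul0r.
  by rewrite ltnn mulr0.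
have /eqP/det0P[v v0 vZ] := Zi.
pose y := v^T.
have y_high (l : 'I_n) : (i < l)%N -> y l 0 = 0.
  move=> il; have /rowP/(_ l) := vZ; rewrite !mxE => <-.
  rewrite (bigD1 l) //= big1 => [|m ml].
    by rewrite !mxE ltnNge (ltnW il) /= il eqxx mulr1 addr0.
  by rewrite !mxE ltnNge (ltnW il) /= (negPf ml) andbF mulr0.
have Gy_low (l : 'I_n) : (l < i)%N -> (G *m y) l 0 = 0.
  move=> li; transitivity ((v *m Z) 0 l); last by rewrite vZ mxE.
  rewrite mxE [RHS]mxE; apply: eq_bigr => m _.
  by rewrite [y _ _]mxE [Z _ _]mxE li mulrC.
have y_pos : 0 < nrm2 y.
  rewrite lt_def nrm2_ge0 andbT; apply: contraNN v0 => /eqP/nrm2_eq0 y0.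
  by rewrite -[v]trmxK -/y y0 trmx0.
have nUy : nrm2 (U *m y) = nrm2 y by rewrite (isometry_nrm2 _ UU).
have nGy : nrm2 (G *m y) = nrm2 y.
  by rewrite defG -mulmxA (isometry_nrm2 _ (unitary_adj VV)).
(* The test vector [U *m y] has coordinates [y] in the basis [U], supported on indices up to [i],
   and [G *m y] in the basis [V], supported on indices from [i] on. *)
have eH : retr ((U *m y)^t* *m H *m (U *m y)) =
    \sum_l h l * \sum_j sqmod (y l j).
  by rewrite HE retr_quad (mulmxA _ U) UU mul1mx.
have eK : retr ((U *m y)^t* *m K *m (U *m y)) =
    \sum_l g l * \sum_j sqmod ((G *m y) l j).
  by rewrite KE retr_quad (mulmxA _ U) -defG.
have := HK (U *m y); rewrite [X in X + _ <= _]eH [X in _ <= X]eK nUy => HKy.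
have row_ge0 (z : 'cV[C]_n) l : 0 <= \sum_j sqmod (z l j).
  by apply: sumr_ge0 => j _; exact: sqmod_ge0.
have row_eq0 (z : 'cV[C]_n) l : z l 0 = 0 -> \sum_j sqmod (z l j) = 0.
  by move=> z0; rewrite big_ord1 z0 /sqmod expr0n addr0.
have lo : h i * nrm2 y <= \sum_l h l * \sum_j sqmod (y l j).
  rewrite nrm2E mulr_sumr; apply: ler_sum => l _.
  have [li|il] := leqP l i.
    exact: ler_wpM2r (row_ge0 y l) _ _ (h_dec li).
  by rewrite row_eq0 ?mulr0 ?y_high.
have hi : \sum_l g l * \sum_j sqmod ((G *m y) l j) <= g i * nrm2 y.
  rewrite -nGy nrm2E mulr_sumr; apply: ler_sum => l _.
  have [li|il] := ltnP l i; last first.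
    exact: ler_wpM2r (row_ge0 (G *m y) l) _ _ (g_dec il).
  by rewrite row_eq0 ?mulr0 ?Gy_low.
rewrite -(ler_pM2r y_pos) mulrDl.
by apply: le_trans hi; apply: le_trans HKy; rewrite lerD2r.
Qed.

End Weyl.

Section Lidskii.
Variables (n : nat) (H K U V W : 'M[C]_n) (h g delta : 'I_n -> R).
Hypotheses (UU : U^t* *m U = 1%:M) (VV : V^t* *m V = 1%:M).
Hypotheses (WW : W^t* *m W = 1%:M).
Hypotheses (HE : H = U *m rdiag h *m U^t*) (KE : K = V *m rdiag g *m V^t*).
Hypotheses (DE : K - H = W *m rdiag delta *m W^t*).
Hypotheses (h_dec : antitone h) (g_dec : antitone g) (d_dec : antitone delta).

(* After Li and Mathias: raise the eigenvalues of K - H that lie below the p-th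
   one, mu, up to mu. This only increases the eigenvalues of K, all of them then
   exceed those of H by at least mu, and the total excess over mu is the excess
   of the trace. *)
Lemma lidskii (I : {set 'I_n}) :
  \sum_(i in I) (g i - h i) <= \sum_(i < n | (i < #|I|)%N) delta i.
Proof.
have [/eqP|I_gt0] := posnP #|I|.
  by rewrite cards_eq0 => /eqP ->; rewrite cards0 !big_pred0 // => i; rewrite ?inE.
have In : (#|I| <= n)%N by rewrite -[X in (_ <= X)%N]card_ord max_card.
(* Counting from zero, the eigenvalue of rank [#|I|] has index [#|I|.-1]; this is why empty [I] is
   treated apart. *)
have pn : (#|I|.-1 < n)%N by rewrite prednK.
set mu := delta (Ordinal pn).
have [L defL] : exists L, L = W *m rdiag (fun i => Num.max (delta i) mu) *m W^t*.
  by eexists; reflexivity.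
have KD : K = H + W *m rdiag delta *m W^t* by rewrite -DE addrC subrK.
have HJ : H^t* = H by rewrite HE diag_adj.
have LJ : L^t* = L by rewrite defL diag_adj.
have GJ : (H + L)^t* = H + L by rewrite adjmxD HJ LJ.
have [Q [QQ GE f_dec]] := spectral_theorem GJ.
set f := (fun i => eigvals (H + L) 0 i) in GE f_dec.
have gf : forall i, g i + 0 <= f i.
  apply: (weyl_monotone VV QQ KE GE g_dec f_dec) => x; rewrite mul0r addr0.
  rewrite KD !(mulmxDr (x^t*)).
  rewrite (mulmxDl _ _ x) (mulmxDl _ _ x) [leLHS]retrD [leRHS]retrD lerD2l defL.
  by apply: quad_le => i; rewrite le_max lexx.
have hf : forall i, h i + mu <= f i.
  apply: (weyl_monotone UU QQ HE GE h_dec f_dec) => x.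
  rewrite mulmxDr mulmxDl [leRHS]retrD lerD2l defL.
  have -> : mu * nrm2 x = retr (x^t* *m (W *m rdiag (fun=> mu) *m W^t*) *m x).
    rewrite [RHS]retr_quad -mulr_sumr -nrm2E.
    by rewrite (isometry_nrm2 _ (unitary_adj WW)).
  by apply: quad_le => i; rewrite le_max lexx orbT.
have trG : \sum_i f i = \sum_i h i + \sum_i Num.max (delta i) mu.
  by rewrite -(retr_diag f QQ) -GE retrD HE defL (retr_diag _ UU) (retr_diag _ WW).
(* Inside [I], [gf] replaces [g] by [f]; outside, [hf] makes the added terms nonnegative. *)
have step1 : \sum_(i in I) (g i - h i - mu) <= \sum_i (f i - h i - mu).
  rewrite [leRHS](bigID (mem I)) /= -[leLHS]addr0; apply: lerD.
    by apply: ler_sum => i _; rewrite !lerD2r -[leLHS]addr0.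
  by apply: sumr_ge0 => i _; rewrite -addrA -opprD subr_ge0.
(* After the trace identity, [max (delta i) mu - mu] is [delta i - mu] before index [#|I|] and zero
   from there on. *)
have step2 : \sum_i (f i - h i - mu) = \sum_(i < n | (i < #|I|)%N) (delta i - mu).
  rewrite !sumrB trG (addrC (\sum_i h i)) addrK -!sumrB [RHS]big_mkcond /=.
  apply: eq_bigr => i _; case: ltnP => iI.
    rewrite max_l //; apply: d_dec; rewrite /= -ltnS prednK //.
  by rewrite max_r ?subrr //; apply: d_dec; rewrite /= (leq_trans (leq_pred _)).
move: step1; rewrite step2 !sumrB.
suff -> : \sum_(i in I) mu = \sum_(i < n | (i < #|I|)%N) mu by rewrite lerD2r.
by rewrite sumr_const (big_ord_narrow In) /= sumr_const card_ord.
Qed.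

End Lidskii.

(** Split [I] by the sign of [g i - h i]. The Lidskii bound for [K - H] selects the top eigenvalues
    [delta] for one half; for [H - K], whose sorted eigenvalues are [- delta] reversed, it selects
    the bottom ones for the other. [J] is the union of the two selections. *)
Lemma mirsky n (H K U V W : 'M[C]_n) (h g delta : 'I_n -> R) :
  U^t* *m U = 1%:M -> V^t* *m V = 1%:M -> W^t* *m W = 1%:M ->
  H = U *m rdiag h *m U^t* -> K = V *m rdiag g *m V^t* ->
  K - H = W *m rdiag delta *m W^t* ->
  antitone h -> antitone g -> antitone delta ->
  forall I : {set 'I_n}, exists2 J : {set 'I_n}, (#|J| <= #|I|)%N &
    \sum_(i in I) `|h i - g i| <= \sum_(i in J) `|delta i|.
Proof.
move=> UU VV WW HE KE DE h_dec g_dec d_dec I.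
pose r := perm (@rev_ord_inj n).
pose delta' i := - delta (r i).
have d'_dec : antitone delta'.
  move=> i j ij; rewrite lerN2; apply: d_dec; rewrite !permE /=.
  by rewrite leq_sub2l.
have DE' : H - K = col_perm r W *m rdiag delta' *m (col_perm r W)^t*.
  rewrite -(diag_col_perm W (fun i => - delta i)) -opprB DE -mulNmx -mulmxN.
  congr (_ *m _ *m _); apply/matrixP => i j.
  by rewrite mxE !rdiagE rmorphN mulNrn.
have W'W' := col_perm_unitary r WW.
pose S := [set i | h i <= g i].
pose I1 := I :&: S; pose I2 := I :\: S.
have card_I : (#|I1| + #|I2|)%N = #|I| by rewrite cardsID.
have In : (#|I| <= n)%N by rewrite -[X in (_ <= X)%N]card_ord max_card.
have I1n : (#|I1| <= n)%N by rewrite (leq_trans _ In) // -card_I leq_addr.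
have I2n : (#|I2| <= n)%N by rewrite (leq_trans _ In) // -card_I leq_addl.
pose J1 := [set l : 'I_n | (l < #|I1|)%N].
pose J2 := [set l : 'I_n | (rev_ord l < #|I2|)%N].
have card_J1 : #|J1| = #|I1|.
  by rewrite -sum1dep_card (big_ord_narrow I1n) sum1_card card_ord.
have card_J2 : #|J2| = #|I2|.
  rewrite -sum1dep_card (reindex_inj rev_ord_inj).
  under eq_bigl => i do rewrite rev_ordK.
  by rewrite (big_ord_narrow I2n) sum1_card card_ord.
exists (J1 :|: J2).
  by rewrite (leq_trans (leq_card_setU _ _)) // card_J1 card_J2 card_I.
have -> : \sum_(i in I) `|h i - g i| =
    \sum_(i in I1) (g i - h i) + \sum_(i in I2) (h i - g i).
  rewrite (big_setID S) /=; congr (_ + _); apply: eq_bigr => i; rewrite !inE.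
    by case/andP => _ hg; rewrite distrC ger0_norm // subr_ge0.
  by case/andP; rewrite -ltNge => gh _; rewrite gtr0_norm // subr_gt0.
have le1 := lidskii UU VV WW HE KE DE h_dec g_dec d_dec I1.
have le2 := lidskii VV UU W'W' KE HE DE' g_dec h_dec d'_dec I2.
(* A common index [l] would satisfy [l < #|I1|] and [n - 1 - l < #|I2|], forcing
   [#|I1| + #|I2| > n]. *)
have disj : [disjoint J1 & J2].
  rewrite -finset.setI_eq0; apply/eqP/finset.setP => l; rewrite !inE /=.
  apply/negbTE; rewrite negb_and -!leqNgt.
  by move: card_I In (ltn_ord l); move: #|I1| #|I2| #|I| (nat_of_ord l); lia.
rewrite [leRHS](eq_bigl (fun i => i \in [predU J1 & J2])); last first.
  by move=> i; rewrite finset.in_setU.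
rewrite [leRHS](bigU _ _ _ disj); apply: lerD.
  apply: le_trans le1 _; rewrite big_mkcond [leRHS]big_mkcond.
  by apply: ler_sum => i _; rewrite inE; case: ifP => // _; exact: ler_norm.
apply: le_trans le2 _; rewrite (reindex_inj rev_ord_inj).
rewrite big_mkcond [leRHS]big_mkcond; apply: ler_sum => i _; rewrite inE.
case: ifP => // _.
by rewrite /delta' permE rev_ordK -normrN ler_norm.
Qed.

End LidskiiMirsky.

(** * The Sylvester equation *)

Section Sylvester.
Context {R : realType}.
Local Notation C := R[i].

(** The [j] largest entries of [x] occupy some index set of size [j], and [y] is already sorted. *)
Lemma submajorized_subsets k (x y : 'rV[R]_k) : antitone (fun i => y 0 i) ->
  (forall I : {set 'I_k},
     \sum_(i in I) x 0 i <= \sum_(i < k | (i < #|I|)%N) y 0 i) ->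
  submajorized x y.
Proof.
move=> y_dec xy j /andP[_ jk].
have y_sort i : decreasing_rearrangement y 0 i = y 0 i.
  by rewrite mxE (sort_antitone y_dec).
have [p _ p_sort] := sort_codom_perm (fun i => x 0 i).
under [leRHS]eq_bigr => i _ do rewrite y_sort.
pose I := [set p i | i in [set i : 'I_k | (i < j)%N]].
have card_I : #|I| = j.
  rewrite card_imset; last exact: perm_inj.
  by rewrite -sum1dep_card (big_ord_narrow jk) sum1_card card_ord.
have := xy I; rewrite card_I; apply: le_trans.
rewrite big_imset /=; last by move=> ? ? _ _; exact: perm_inj.
rewrite le_eqVlt; apply/orP; left; apply/eqP.
by apply: eq_big => i; [rewrite inE | rewrite mxE p_sort].
Qed.

(** The lines [2 t - b t^2] are tangents of [1 / b]; for [b > 0], [t = b^-1] gives [b^-1 <= c]. For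
    [b = 0] the instances [t = 0] and [t = c + 1] contradict each other. *)
Lemma mulr_ge1_tangent (b c : R) : 0 <= b ->
  (forall t, 2 * t - b * t ^+ 2 <= c) -> 1 <= c * b.
Proof.
rewrite le_eqVlt => /predU1P[<- | b_gt0] tangent.
  by have := tangent 0; have := tangent (c + 1); rewrite !mul0r; lra.
have H := tangent b^-1; rewrite -(ler_pM2r b_gt0) in H; apply: le_trans H.
have -> : (2 * b^-1 - b * b^-1 ^+ 2) * b = (2 - b * b^-1) * (b^-1 * b) by ring.
by rewrite mulfV ?mulVf ?gt_eqF // mulr1; lra.
Qed.

Lemma unitary_col_sqmod n (W : 'M[C]_n) i :
  W^t* *m W = 1%:M -> \sum_l sqmod (W l i) = 1.
Proof.
move=> /matrixP/(_ i i)/(congr1 (@complex.Re R)); rewrite !mxE eqxx /=.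
by rewrite complexRe_sum => <-; apply: eq_bigr => l _; rewrite adjmxE Re_conjM.
Qed.

Lemma sqmodJ (z : C) : sqmod z^*%R = sqmod z.
Proof. by case: z => a b; rewrite /sqmod /= sqrrN. Qed.

Lemma unitary_row_sqmod n (W : 'M[C]_n) l :
  W^t* *m W = 1%:M -> \sum_i sqmod (W l i) = 1.
Proof.
move=> /unitary_adj/(unitary_col_sqmod l) <-; apply: eq_bigr => i _.
by rewrite adjmxE sqmodJ.
Qed.

Section WeightedKyFan.
Variables (k : nat) (M W : 'M[C]_k) (a : nat -> R) (tau : 'I_k -> R).
Hypotheses (M_a : kyfan_bounded M a) (WW : W^t* *m W = 1%:M).
Hypotheses (tau_dec : antitone tau) (tau_ge0 : forall l, 0 <= tau l).
Variable j : nat.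

(** Abel summation over [l] leaves partial sums [\sum_(i in J) |e i| * q i] with [0 <= q i <= 1];
    these are traces of [M] against diagonal contractions. *)
Lemma kyfan_weighted (J : {set 'I_k}) : (#|J| <= j)%N ->
  \sum_(i in J) `|complex.Re (M i i)| * (\sum_l tau l * sqmod (W l i)) <=
  \sum_(l < k | (l < j)%N) a l * tau l.
Proof.
move=> Jj; pose e i := complex.Re (M i i).
pose t l := \sum_(i in J) `|e i| * sqmod (W l i).
pose b l := if (l < j)%N then a l else 0.
have -> : \sum_(i in J) `|e i| * (\sum_l tau l * sqmod (W l i)) =
    \sum_(l < k) zero_ext tau l * zero_ext t l.
  under eq_bigr do rewrite mulr_sumr.
  rewrite exchange_big /=; apply: eq_bigr => l _.
  by rewrite !zero_extE mulr_sumr; apply: eq_bigr => i _; rewrite mulrCA.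
have -> : \sum_(l < k | (l < j)%N) a l * tau l = \sum_(l < k) zero_ext tau l * b l.
  rewrite big_mkcond; apply: eq_bigr => l _; rewrite zero_extE /b.
  by case: ifP; rewrite ?mulr0 // mulrC.
apply: abel_le => [l m|l _|p _].
- exact: zero_ext_antitone.
- exact: zero_ext_ge0.
pose q i := \sum_(l < k | (l < p)%N) sqmod (W l i).
have q_ge0 i : 0 <= q i by apply: sumr_ge0 => l _; exact: sqmod_ge0.
have q_le1 i : q i <= 1.
  rewrite -(unitary_col_sqmod i WW) [leLHS]big_mkcond; apply: ler_sum => l _.
  by case: ifP => // _; exact: sqmod_ge0.
(* The bound [j] counts [J] with each [q i] at most one; the bound [p] sums over all [i] first and
   uses that the rows of [W] have norm one. *)
have sum_q : \sum_(i in J) q i <= (minn j p)%:R.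
  suff [sum_j sum_p] : \sum_(i in J) q i <= j%:R /\ \sum_(i in J) q i <= p%:R.
    by rewrite /minn; case: ifP.
  split.
    apply: (@le_trans _ _ (#|J|%:R)); last by rewrite ler_nat.
    by rewrite -sumr_const; exact: ler_sum.
  apply: (@le_trans _ _ (\sum_i q i)).
    by rewrite [leLHS]big_mkcond; apply: ler_sum => i _; case: ifP.
  rewrite exchange_big /= (eq_bigr (fun=> 1)) => [|l _]; last first.
    exact: unitary_row_sqmod.
  rewrite -(sum_zero_ext (fun=> 1)) -[X in _ <= X%:R]card_ord -sumr_const.
  by apply: ler_sum => l _; rewrite /zero_ext; case: (insub _) => /=.
(* Each weight [q i] is split evenly between the two test matrices, and the sign of [e i] is put
   into [u] to produce absolute values. *)
pose w i := if i \in J then Num.sqrt (q i) else 0.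
pose u i := Num.sg (e i) * w i.
have w_sq i : w i ^+ 2 = if i \in J then q i else 0.
  by rewrite /w; case: ifP; rewrite ?expr0n // sqr_sqrtr.
have u_sq i : u i ^+ 2 <= w i ^+ 2.
  rewrite exprMn ler_piMl ?sqr_ge0 // sqr_sg.
  by case: (e i != 0).
have w_contr : contraction (rdiag w).
  by apply: rdiag_contraction => i; rewrite w_sq; case: ifP.
have u_contr : contraction (rdiag u).
  apply: rdiag_contraction => i; apply: le_trans (u_sq i) _.
  by rewrite w_sq; case: ifP.
have w_nrm : nrm2 (rdiag w) <= (minn j p)%:R.
  by rewrite nrm2_rdiag; under eq_bigr do rewrite w_sq; rewrite -big_mkcond.
have u_nrm : nrm2 (rdiag u) <= (minn j p)%:R.
  by apply: le_trans w_nrm; rewrite !nrm2_rdiag; exact: ler_sum.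
have := M_a u_contr w_contr u_nrm w_nrm.
have -> : retr ((rdiag u)^t* *m M *m rdiag w) = \sum_(l < p) zero_ext t l.
  rewrite rdiagJ -mulmxA [LHS]retrC -mulmxA rdiagM.
  rewrite retrC retr_rdiagM sum_zero_ext exchange_big [RHS]big_mkcond /=.
  apply: eq_bigr => i _; rewrite -/(e i) /u /w; case: ifP => _; last first.
    by rewrite mul0r mul0r.
  rewrite -mulr_sumr -/(q i) mulrCA -expr2 sqr_sqrtr //.
  by rewrite mulrAC -normrEsg.
suff -> : \sum_(l < p) b l = \sum_(l < minn j p) a l by [].
rewrite [RHS](big_ord_widen _ _ (geq_minr j p)) [RHS]big_mkcond.
by apply: eq_bigr => l _; rewrite /b leq_min ltn_ord andbT.
Qed.

End WeightedKyFan.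

Section SylvesterBound.
Variables (k : nat) (H K T F V : 'M[C]_k) (sigma : 'I_k -> R) (a : nat -> R).
Hypotheses (HJ : H^t* = H) (KJ : K^t* = K).
Hypotheses (FF : F^t* *m F = 1%:M) (VV : V^t* *m V = 1%:M).
Hypotheses (sigma_dec : antitone sigma) (sigma_gt0 : forall l, 0 < sigma l).
Hypothesis T_svd : T = V *m rdiag sigma *m F^t*.
Hypothesis E_a : kyfan_bounded (K *m T - T *m H) a.

(** The eigenvectors of the conjugate are those of [M] moved by [U^t*]. *)
Lemma eigvals_conj (M U : 'M[C]_k) : M^t* = M -> U^t* *m U = 1%:M ->
  exists2 Q : 'M[C]_k, Q^t* *m Q = 1%:M &
    U^t* *m M *m U = Q *m rdiag (fun i => eigvals M 0 i) *m Q^t*.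
Proof.
move=> MJ UU; have [Q [QQ ME _]] := spectral_theorem MJ.
exists (U^t* *m Q).
  by rewrite adjmxM trmxCK mulmxA -(mulmxA _ U) unitary_comm ?mulmx1.
by rewrite [in LHS]ME adjmxM trmxCK !mulmxA.
Qed.

Lemma sylvester_eigvals (I : {set 'I_k}) :
  \sum_(i in I) `|eigvals H 0 i - eigvals K 0 i| <=
  \sum_(l < k | (l < #|I|)%N) a l * (sigma (rev_ord l))^-1.
Proof.
have [QH QHQ HE] := eigvals_conj HJ FF; have [QK QKQ KE] := eigvals_conj KJ VV.
have [_ [_ _ h_dec]] := spectral_theorem HJ.
have [_ [_ _ g_dec]] := spectral_theorem KJ.
have [H' H'E] : exists H', H' = F^t* *m H *m F by eexists; reflexivity.
have [K' K'E] : exists K', K' = V^t* *m K *m V by eexists; reflexivity.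
rewrite -H'E in HE; rewrite -K'E in KE.
have H'J : H'^t* = H' by rewrite HE diag_adj.
have K'J : K'^t* = K' by rewrite KE diag_adj.
have DJ : (K' - H')^t* = K' - H' by rewrite adjmxB K'J H'J.
have [W [WW DE d_dec]] := spectral_theorem DJ.
set delta := (fun i => eigvals (K' - H') 0 i) in DE d_dec.
have [J JI] := mirsky QHQ QKQ WW HE KE DE h_dec g_dec d_dec I.
move=> /le_trans; apply.
have [S SE] : exists S, S = rdiag sigma by eexists; reflexivity.
have TE : T = V *m S *m F^t* by rewrite SE.
have SJ : S^t* = S by rewrite SE rdiagJ.
have E'E : V^t* *m (K *m T - T *m H) *m F = K' *m S - S *m H'.
  rewrite mulmxBr mulmxBl TE K'E H'E -!mulmxA FF mulmx1.
  by rewrite (mulmxA (V^t*) V) VV mul1mx.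
have [M ME] : exists M, M = W^t* *m (K' *m S - S *m H') *m W.
  by eexists; reflexivity.
have M_a : kyfan_bounded M a.
  rewrite ME; apply: kyfan_bounded_mulr; first exact: isometry_contraction.
  apply: kyfan_bounded_mull; first exact: isometry_contraction.
  rewrite -E'E; apply: kyfan_bounded_mulr; first exact: isometry_contraction.
  by apply: kyfan_bounded_mull => //; exact: isometry_contraction.
have [B BE] : exists B, B = W^t* *m S *m W by eexists; reflexivity.
pose b i := \sum_l sigma l * sqmod (W l i).
have ReB i : complex.Re (B i i) = b i.
  rewrite BE SE -mulmxA mxE complexRe_sum; apply: eq_bigr => l _.
  by rewrite adjmxE mul_rdiag_mx mulrCA complexReMl Re_conjM.
(* Adding the adjoint regroups [K' S - S H' + S K' - H' S] as [D S + S D] with [D = K' - H'], which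
   [W] diagonalises. *)
have MMJ : M + M^t* = rdiag delta *m B + B *m rdiag delta.
  have -> : M + M^t* = W^t* *m ((K' - H') *m S + S *m (K' - H')) *m W.
    rewrite ME !adjmxM trmxCK adjmxB !adjmxM H'J K'J SJ mulmxA.
    rewrite -mulmxDl -mulmxDr mulmxBl mulmxBr.
    suff -> : K' *m S - S *m H' + (S *m K' - H' *m S) =
      K' *m S - H' *m S + (S *m K' - S *m H') by [].
    by rewrite addrACA [RHS]addrACA [- _ - _]addrC.
  rewrite DE mulmxDr mulmxDl BE -!mulmxA (mulmxA (W^t*) W) WW mul1mx.
  by rewrite mulmx1.
(* The diagonal entry reads [2 Re (M i i) = 2 delta i b i]. *)
have ReM i : complex.Re (M i i) = delta i * b i.
  have := congr1 (fun N : 'M[C]_k => complex.Re (N i i)) MMJ.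
  rewrite [(M + _) i i]mxE [(_ + B *m _) i i]mxE mul_rdiag_mx mul_mx_rdiag.
  rewrite adjmxE !complexReD complexReJ mulrC [B i i * _]mulrC complexReMl ReB.
  lra.
(* The inverses of the antitone [sigma] increase, so weights and rows of [W] are reversed together
   to meet the monotonicity required by [kyfan_weighted]. *)
pose r := perm (@rev_ord_inj k).
pose W' := row_perm r W.
have W'W' : W'^t* *m W' = 1%:M.
  rewrite -WW; apply/matrixP => i l; rewrite !mxE.
  by rewrite [RHS](reindex_inj (@perm_inj _ r)); apply: eq_bigr => m _; rewrite !mxE.
pose tau l := (sigma (rev_ord l))^-1.
have tau_dec : antitone tau by exact: antitone_rev_inv.
have tau_ge0 l : 0 <= tau l by rewrite invr_ge0 ltW.
apply: le_trans (kyfan_weighted M_a W'W' tau_dec tau_ge0 JI).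
apply: ler_sum => i _; rewrite ReM normrM -mulrA ler_peMr //.
have b_ge0 : 0 <= b i.
  by apply: sumr_ge0 => l _; rewrite mulr_ge0 ?sqmod_ge0 // ltW.
rewrite (ger0_norm b_ge0) mulrC; apply: mulr_ge1_tangent => // t.
have -> : \sum_l tau l * sqmod (W' l i) = \sum_l (sigma l)^-1 * sqmod (W l i).
  rewrite [RHS](reindex_inj rev_ord_inj); apply: eq_bigr => l _.
  by rewrite mxE permE.
(* Jensen's inequality for the inverse: the weights [sqmod (W l i)] sum to one, so the tangent bound
   is an average of the bounds at each [sigma l], where the gap is a multiple of a square. *)
have -> : 2 * t - b i * t ^+ 2 =
    \sum_l (2 * t - sigma l * t ^+ 2) * sqmod (W l i).
  under [RHS]eq_bigr do rewrite mulrBl.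
  rewrite sumrB -mulr_sumr (unitary_col_sqmod _ WW) mulr1; congr (_ - _).
  by rewrite mulr_suml; apply: eq_bigr => l _; rewrite mulrAC.
apply: ler_sum => l _; apply: ler_wpM2r; first exact: sqmod_ge0.
rewrite -subr_ge0.
have -> : (sigma l)^-1 - (2 * t - sigma l * t ^+ 2) =
    sigma l * ((sigma l)^-1 - t) ^+ 2.
  by field; rewrite gt_eqF.
by rewrite mulr_ge0 ?sqr_ge0 // ltW.
Qed.

End SylvesterBound.

End Sylvester.

(** * Projectors and principal angles *)

Section OrthogonalProjector.
Context {R : realType}.
Local Notation C := R[i].
Variables (d : nat) (Z : {vspace 'cV[C]_d}).
Local Notation P := (orthoproj Z).
Local Notation basis_mx := (\matrix_(i < \dim Z) ((vbasis Z)`_i)^T).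

Lemma vspace_submx (v : 'cV[C]_d) : v \in Z -> (v^T <= basis_mx)%MS.
Proof.
move=> /coord_vbasis ->; rewrite linear_sum /=; apply: summx_sub => i _.
rewrite linearZ /= scalemx_sub //.
by have := row_sub i basis_mx; rewrite rowK.
Qed.

Lemma cols_submx k (M : 'M[C]_(d, k)) :
  (forall j, col j M \in Z) -> (M^T <= basis_mx)%MS.
Proof.
by move=> MZ; apply/row_subP => j; rewrite -tr_col; exact: vspace_submx.
Qed.

Lemma orthoproj_id k (M : 'M[C]_(d, k)) :
  (forall j, col j M \in Z) -> P *m M = M.
Proof.
by move=> /cols_submx MZ; apply: trmx_inj; rewrite trmx_mul trmxK proj_ortho_id.
Qed.

(** For [Q] the row projector, the rows of [Q] lie in the space and those of [1 - Q] are orthogonal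
    to it. Hence [(1 - Q) Q^* = 0], so [Q^* = Q Q^*] is self-adjoint. *)
Lemma orthoproj_adj : P^t* = P.
Proof.
rewrite /orthoproj; have Q_sub := proj_ortho_sub basis_mx (1%:M : 'M[C]_d).
have /orthomx1P := proj_ortho_compl_sub basis_mx (1%:M : 'M[C]_d).
rewrite mul1mx in Q_sub *; move: (proj_ortho _) Q_sub => Q Q_sub QM.
have QJ : Q^t* = Q.
  have /submxP[D QE] := Q_sub.
  have QQ : (1%:M - Q) *m Q^t* = 0.
    by rewrite [X in _ *m X^t*]QE adjmxM mulmxA QM mul0mx.
  have H : Q^t* = Q *m Q^t*.
    by apply/eqP; rewrite -subr_eq0 -[X in X - _]mul1mx -mulmxBl QQ.
  have := congr1 (fun M : 'M[C]_d => M^t*) H; rewrite /= adjmxM !trmxCK => H2.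
  by rewrite H -H2.
by rewrite -[in RHS]QJ trmxK map_trmx trmxK.
Qed.

(** Equality of dimensions makes the columns of [Y] span [Z], so [P = Y D^T]; then
    [D^T = Y^* P = (P Y)^* = Y^*]. *)
Lemma orthoproj_onb k (Y : 'M[C]_(d, k)) : \dim Z = k ->
  (forall j, col j Y \in Z) -> Y^t* *m Y = 1%:M -> P = Y *m Y^t*.
Proof.
move=> dimZ YZ YY.
have rankY : \rank Y^T = k.
  apply: mxrank_unitary; apply/unitarymxP; rewrite trmxK.
  by rewrite -[RHS]trmx1 -YY trmx_mul map_trmx trmxK.
have /submxP[D PE] : (P^T <= Y^T)%MS.
  have sub : (P^T <= basis_mx)%MS.
    rewrite trmxK; have := proj_ortho_sub basis_mx (1%:M : 'M[C]_d).
    by rewrite mul1mx.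
  apply: submx_trans sub _; rewrite -(geq_leqif (mxrank_leqif_sup (cols_submx YZ))).
  by rewrite rankY (leq_trans (rank_leq_row _)) ?dimZ.
have {}PE : P = Y *m D^T by rewrite -[LHS]trmxK PE trmx_mul trmxK.
suff <- : D^T = Y^t* by [].
rewrite -[LHS]mul1mx -YY -mulmxA -PE -orthoproj_adj -adjmxM.
by rewrite (orthoproj_id YZ).
Qed.

End OrthogonalProjector.

(** * Cosines and sines of the principal angles *)

Section PrincipalAngles.
Context {R : realType}.
Local Notation C := R[i].

Lemma nrm2_mulmx m n p (B : 'M[C]_(m, n)) (x : 'M[C]_(n, p)) :
  nrm2 (B *m x) = retr (x^t* *m (B^t* *m B) *m x).
Proof. by rewrite /nrm2 adjmxM !mulmxA. Qed.

(** Test the contraction on the [i]-th right singular vector, whose image has squared norm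
    [singvals B 0 i ^+ 2]. *)
Lemma singvals_contraction d k (B : 'M[C]_(d, k)) i :
  contraction B -> singvals B 0 i <= 1.
Proof.
move=> cB; have [V [VV BB _ _]] := gram_singvals B.
have sum_delta (s : 'I_k -> R) :
    \sum_l s l * \sum_j sqmod ((delta_mx i 0 : 'cV[C]_k) l j) = s i.
  have rowE l : \sum_j sqmod ((delta_mx i 0 : 'cV[C]_k) l j) = (l == i)%:R.
    rewrite big_ord1 mxE eqxx andbT /sqmod.
    by case: (l == i); rewrite /= expr0n ?expr1n addr0.
  under eq_bigr do rewrite rowE.
  by rewrite (bigD1 i) //= eqxx mulr1 big1 ?addr0 // => l /negPf ->; rewrite mulr0.
have := cB _ (V *m delta_mx i 0 : 'cV[C]_k).
rewrite (isometry_nrm2 _ VV).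
have -> : nrm2 (B *m (V *m delta_mx i 0 : 'cV[C]_k)) = singvals B 0 i ^+ 2.
  by rewrite nrm2_mulmx BB retr_quad (mulmxA _ V) VV mul1mx sum_delta.
have -> : nrm2 (delta_mx i 0 : 'cV[C]_k) = 1.
  by rewrite nrm2E -(sum_delta (fun=> 1)); apply: eq_bigr => l _; rewrite mul1r.
by rewrite expr_le1 // singvals_ge0.
Qed.

(* In the right singular basis of S = X^* Y, the Gram matrix 1 - S^* S of
   (1 - X X^* ) Y is diagonal. *)
Lemma singvals_sines d k (X Y : 'M[C]_(d, k)) (G : 'M[C]_k) (sigma : 'I_k -> R) :
  X^t* *m X = 1%:M -> Y^t* *m Y = 1%:M -> G^t* *m G = 1%:M ->
  (X^t* *m Y)^t* *m (X^t* *m Y) = G *m rdiag (fun i => sigma i ^+ 2) *m G^t* ->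
  antitone sigma -> (forall i, 0 <= sigma i <= 1) ->
  forall i, singvals (Y - X *m (X^t* *m Y)) 0 i =
    Num.sqrt (1 - sigma (rev_ord i) ^+ 2).
Proof.
move=> XX YY GG; set S := X^t* *m Y => SS s_dec s01.
pose r := perm (@rev_ord_inj k).
have sq_le1 i : 0 <= 1 - sigma i ^+ 2.
  by have /andP[s0 s1] := s01 i; rewrite subr_ge0 expr_le1.
apply: (singvals_unique (col_perm_unitary r GG)); last 2 first.
- by apply: antitone_sines => // i; have /andP[] := s01 i.
- by move=> i; exact: sqrtr_ge0.
have -> : rdiag (fun i => Num.sqrt (1 - sigma (rev_ord i) ^+ 2) ^+ 2) =
    rdiag (fun i => 1 - sigma (r i) ^+ 2).
  by apply: eq_rdiag => i; rewrite sqr_sqrtr // permE.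
rewrite -(diag_col_perm G (fun i => 1 - sigma i ^+ 2)).
have -> : G *m rdiag (fun i => 1 - sigma i ^+ 2) *m G^t* = 1%:M - S^t* *m S.
  by rewrite -rdiagB rdiag1 mulmxBr mulmx1 mulmxBl -SS unitary_comm.
have YX : Y^t* *m X = S^t* by rewrite /S adjmxM trmxCK.
have XY : X^t* *m Y = S by [].
clearbody S; rewrite adjmxB adjmxM mulmxBr !mulmxBl YY (mulmxA _ X) YX.
rewrite -!(mulmxA (S^t*)) XY (mulmxA (X^t*)) XX mul1mx.
by rewrite [X in _ - X]subrr subr0.
Qed.

End PrincipalAngles.

(** * Ritz values *)

Section RitzValues.
Context {R : realType}.
Local Notation C := R[i].
Variables (d k : nat) (A : 'M[C]_d) (X Y : 'M[C]_(d, k)).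
Hypotheses (AJ : A^t* = A) (XX : X^t* *m X = 1%:M) (YY : Y^t* *m Y = 1%:M).
Local Notation sigma := (fun i => singvals (X^t* *m Y) 0 i).
Hypothesis sigma_gt0 : forall i, 0 < sigma i.

Lemma rayleigh_adj (Z : 'M[C]_(d, k)) : (rayleigh A Z)^t* = rayleigh A Z.
Proof. by rewrite /rayleigh !adjmxM trmxCK AJ mulmxA. Qed.

Lemma residual_orth (Z : 'M[C]_(d, k)) :
  Z^t* *m Z = 1%:M -> Z^t* *m residual A Z = 0.
Proof.
move=> ZZ; rewrite /residual mulmxBr (mulmxA (Z^t*) Z) ZZ mul1mx /rayleigh.
by rewrite mulmxA subrr.
Qed.

Lemma singvals_cosines_le1 i : sigma i <= 1.
Proof.
apply: singvals_contraction; apply: contractionM.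
  by apply: contractionJ; exact: isometry_contraction.
exact: isometry_contraction.
Qed.

(** Common source of both inequalities, which differ only in the bounds [a] and [b] used for the two
    compressed residuals. *)
Lemma ritz_submajorized (a b : 'I_k -> R) (y : 'rV[R]_k) :
  kyfan_bounded (Y^t* *m residual A X) (zero_ext a) ->
  kyfan_bounded (X^t* *m residual A Y) (zero_ext b) ->
  antitone a -> antitone b -> (forall i, 0 <= a i) -> (forall i, 0 <= b i) ->
  (forall i, y 0 i = (a i + b i) * (sigma (rev_ord i))^-1) ->
  submajorized
    (\row_(i < k)
       `|eigvals (rayleigh A X) 0 i - eigvals (rayleigh A Y) 0 i|) y.
Proof.
move=> Xa Yb a_dec b_dec a_ge0 b_ge0 yE.
have tau_dec := antitone_rev_inv (@singvals_antitone _ _ _ (X^t* *m Y)) sigma_gt0.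
have y_dec : antitone (fun i => (a i + b i) * (sigma (rev_ord i))^-1).
  apply: (antitoneM (antitoneD a_dec b_dec) tau_dec) => i.
    by rewrite addr_ge0.
  by rewrite invr_ge0 ltW.
(* Positive cosines make [F] unitary, so the adjoint decomposition of [Y^* X] has the form required
   by [sylvester_eigvals]. *)
have [F [V [FF _ VV SE]]] := singvals_svd (X^t* *m Y).
have F_unit : F^t* *m F = 1%:M.
  by rewrite FF -rdiag1; apply: eq_rdiag => i; rewrite gt_eqF.
have TE : Y^t* *m X = V *m rdiag sigma *m F^t*.
  by rewrite -[Y^t* *m X]trmxCK adjmxM trmxCK [in LHS]SE !adjmxM trmxCK rdiagJ mulmxA.
have E_ab : kyfan_bounded (rayleigh A Y *m (Y^t* *m X) -
    (Y^t* *m X) *m rayleigh A X) (fun l => zero_ext a l + zero_ext b l).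
  have EX : Y^t* *m residual A X =
      Y^t* *m A *m X - Y^t* *m X *m rayleigh A X.
    by rewrite /residual mulmxBr !mulmxA.
  have EY : (X^t* *m residual A Y)^t* =
      Y^t* *m A *m X - rayleigh A Y *m (Y^t* *m X).
    rewrite adjmxM trmxCK /residual adjmxB (adjmxM A) (adjmxM Y) AJ rayleigh_adj.
    by rewrite mulmxBl !mulmxA.
  (* The term [Y^* A X] is common to both compressed residuals and cancels in their difference. *)
  have -> : rayleigh A Y *m (Y^t* *m X) - (Y^t* *m X) *m rayleigh A X =
      Y^t* *m residual A X - (X^t* *m residual A Y)^t*.
    rewrite EX EY; move: (Y^t* *m A *m X) (_ *m rayleigh A X) (rayleigh A Y *m _).
    by move=> u v w; rewrite opprB [RHS]addrC addrA subrK.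
  exact: (kyfan_boundedD Xa (kyfan_boundedN (kyfan_boundedJ Yb))).
apply: submajorized_subsets => [i j ij|I].
  by rewrite !yE; exact: y_dec.
under eq_bigr do rewrite mxE.
apply: le_trans (sylvester_eigvals (rayleigh_adj X) (rayleigh_adj Y) F_unit VV
  (@singvals_antitone _ _ _ _) sigma_gt0 TE E_ab I) _.
by apply: ler_sum => i _; rewrite yE !zero_extE.
Qed.

End RitzValues.

(** * Ky Fan bounds for the compressed residuals *)

Section ResidualBound.
Context {R : realType}.
Local Notation C := R[i].

Lemma onb_mem d k (X : 'M[C]_(d, k)) (V : {vspace 'cV[C]_d}) j :
  orthonormal_cols_basis X V -> col j X \in V.
Proof.
by case=> bX _; apply: (basis_mem bX); apply/mapP; exists j; rewrite ?mem_enum.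
Qed.

(** Here [P = Y Y^*], so [Y^* P = Y^*], and the isometry [Y] is absorbed as a contraction. *)
Lemma kyfan_bounded_orthoproj d k e (Z : {vspace 'cV[C]_d}) (Y : 'M[C]_(d, k))
    (M : 'M[C]_(d, e)) :
  \dim Z = k -> (forall j, col j Y \in Z) -> Y^t* *m Y = 1%:M ->
  kyfan_bounded (Y^t* *m M)
    (zero_ext (fun i => singvals (orthoproj Z *m M) 0 i)).
Proof.
move=> dimZ YZ YY.
have := kyfan_bounded_mull (isometry_contraction YY)
  (kyfan_bounded_singvals (orthoproj Z *m M)).
suff -> : Y^t* *m (orthoproj Z *m M) = Y^t* *m M by [].
rewrite (orthoproj_onb dimZ YZ YY) -(mulmxA Y) (mulmxA (Y^t*) Y) YY.
by rewrite mul1mx.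
Qed.

(* Y^* R_X = ((1 - X X^* ) Y)^* P R_X, because X^* R_X = 0 and P fixes X and Y. *)
Lemma kyfan_bounded_residual d k (A P : 'M[C]_d) (X Y : 'M[C]_(d, k))
    (G : 'M[C]_k) (sigma : 'I_k -> R) :
  X^t* *m X = 1%:M -> Y^t* *m Y = 1%:M -> G^t* *m G = 1%:M ->
  (X^t* *m Y)^t* *m (X^t* *m Y) = G *m rdiag (fun i => sigma i ^+ 2) *m G^t* ->
  antitone sigma -> (forall i, 0 <= sigma i <= 1) ->
  P^t* = P -> P *m X = X -> P *m Y = Y ->
  kyfan_bounded (Y^t* *m residual A X)
    (zero_ext (fun i => Num.sqrt (1 - sigma (rev_ord i) ^+ 2) *
                        singvals (P *m residual A X) 0 i)).
Proof.
move=> XX YY GG SS s_dec s01 PJ PX PY.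
have sinE := singvals_sines XX YY GG SS s_dec s01.
set B := Y - X *m (X^t* *m Y) in sinE.
have PB : P *m B = B by rewrite mulmxBr PY (mulmxA P) PX.
have -> : Y^t* *m residual A X = B^t* *m (P *m residual A X).
  have -> : B^t* *m (P *m residual A X) = B^t* *m residual A X.
    by rewrite mulmxA -[X in _ *m X *m _]PJ -adjmxM PB.
  rewrite /B adjmxB (adjmxM X) mulmxBl -(mulmxA _ (X^t*)) residual_orth //.
  by rewrite mulmx0 subr0.
move: (P *m residual A X) => M.
have -> : zero_ext (fun i => Num.sqrt (1 - sigma (rev_ord i) ^+ 2) *
      singvals M 0 i) =
    (fun l => zero_ext (fun i => singvals B 0 i) l *
              zero_ext (fun i => singvals M 0 i) l).
  apply/funext => l; rewrite -zero_extM; congr zero_ext.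
  by apply/funext => i; rewrite -(sinE i).
exact: (kyfan_bounded_horn_singvals B (kyfan_bounded_singvals M)).
Qed.

End ResidualBound.

Theorem theorem3p3 (R : realType) (d k : nat) (A : 'M[R[i]]_d)
    (A_sa : A \is hermsymmx)
    (XX YY : {vspace 'cV[R[i]]_d}) (dimXX : \dim XX = k) (dimYY : \dim YY = k)
    (X Y : 'M[R[i]]_(d, k))
    (X_onb : orthonormal_cols_basis X XX)
    (Y_onb : orthonormal_cols_basis Y YY)
    (Theta1_lt : forall i : 'I_k, i = 0%N :> nat ->
       principal_angles X Y 0 i < pi / 2) :
  submajorized
    (\row_(i < k)
       `|eigvals (rayleigh A X) 0 i - eigvals (rayleigh A Y) 0 i|)
    (\row_(i < k)
       ((singvals (orthoproj YY *m residual A X) 0 i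
         + singvals (orthoproj XX *m residual A Y) 0 i)
        / cos (principal_angles X Y 0 i)))
  /\
  submajorized
    (\row_(i < k)
       `|eigvals (rayleigh A X) 0 i - eigvals (rayleigh A Y) 0 i|)
    (\row_(i < k)
       ((singvals (orthoproj (XX + YY)%VS *m residual A X) 0 i
         + singvals (orthoproj (XX + YY)%VS *m residual A Y) 0 i)
        * tan (principal_angles X Y 0 i))).
Proof.
have AJ : A^t* = A.
  by move/is_hermitianmxP: A_sa; rewrite expr0 scale1r => <-.
have [XX1 YY1] : X^t* *m X = 1%:M /\ Y^t* *m Y = 1%:M by case: X_onb Y_onb => _ ? [].
have XXX j := onb_mem j X_onb.
have YYY j := onb_mem j Y_onb.
pose sigma i := singvals (X^t* *m Y) 0 i.
have s_dec : antitone sigma by exact: singvals_antitone.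
have s_le1 i : sigma i <= 1 := singvals_cosines_le1 XX1 YY1 i.
have s_ge0 i : 0 <= sigma i by exact: singvals_ge0.
have s_itv i : sigma i \in `[(-1), 1].
  by rewrite in_itv /= s_le1 andbT (le_trans _ (s_ge0 i)) // lerN10.
have angleE i : principal_angles X Y 0 i = acos (sigma (rev_ord i)) by rewrite mxE.
have cosE i : cos (principal_angles X Y 0 i) = sigma (rev_ord i).
  by rewrite angleE acosK.
have sinE i : sin (principal_angles X Y 0 i) = Num.sqrt (1 - sigma (rev_ord i) ^+ 2).
  by rewrite angleE sin_acos //; have := s_itv (rev_ord i); rewrite in_itv.
(* The angle of index zero is the arccosine of the last, hence smallest, [sigma]; were that zero,
   the largest angle would be [acos 0 = pi / 2]. *)
have s_gt0 i : 0 < sigma i.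
  have k_gt0 : (0 < k)%N by exact: leq_ltn_trans (ltn_ord i).
  have last_le : sigma (rev_ord (Ordinal k_gt0)) <= sigma i.
    by apply: s_dec; rewrite /= subn1 -ltnS prednK.
  apply: lt_le_trans last_le; rewrite lt_def s_ge0 andbT; apply/eqP => s0.
  by have := Theta1_lt (Ordinal k_gt0) erefl; rewrite angleE s0 acos0 ltxx.
have sv_dec (M : 'M[R[i]]_(d, k)) : antitone (fun i => singvals M 0 i).
  exact: singvals_antitone.
have sv_ge0 (M : 'M[R[i]]_(d, k)) i : 0 <= singvals M 0 i.
  exact: singvals_ge0.
split.
  apply: (ritz_submajorized AJ s_gt0
    (kyfan_bounded_orthoproj _ dimYY YYY YY1)
    (kyfan_bounded_orthoproj _ dimXX XXX XX1)
    (sv_dec _) (sv_dec _) (sv_ge0 _) (sv_ge0 _)) => i.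
  by rewrite mxE cosE.
have PJ := orthoproj_adj (XX + YY)%VS.
have PX : orthoproj (XX + YY)%VS *m X = X.
  by apply: orthoproj_id => j; apply: (subvP (addvSl XX YY)).
have PY : orthoproj (XX + YY)%VS *m Y = Y.
  by apply: orthoproj_id => j; apply: (subvP (addvSr XX YY)).
have s01 i : 0 <= sigma i <= 1 by rewrite s_ge0 s_le1.
(* The sine bound is used for [X, Y] and for [Y, X], so both Gram matrices of [X^* Y] are
   diagonalised: one by [V], the other by [F], unitary because [sigma] is positive. *)
have [F [V [FF _ VV SE]]] := singvals_svd (X^t* *m Y).
have F_unit : F^t* *m F = 1%:M.
  by rewrite FF -rdiag1; apply: eq_rdiag => i; rewrite gt_eqF ?s_gt0.
have SSV : (X^t* *m Y)^t* *m (X^t* *m Y) = V *m rdiag (fun i => sigma i ^+ 2) *m V^t*.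
  rewrite [in LHS]SE !adjmxM trmxCK rdiagJ -!mulmxA (mulmxA (F^t*) F) F_unit mul1mx.
  by rewrite (mulmxA (rdiag _) (rdiag _)) rdiagM.
have SSF : (Y^t* *m X)^t* *m (Y^t* *m X) = F *m rdiag (fun i => sigma i ^+ 2) *m F^t*.
  have -> : Y^t* *m X = (X^t* *m Y)^t* by rewrite adjmxM trmxCK.
  rewrite trmxCK [in LHS]SE !adjmxM trmxCK rdiagJ -!mulmxA (mulmxA (V^t*) V) VV mul1mx.
  by rewrite (mulmxA (rdiag _) (rdiag _)) rdiagM.
have tanE i : tan (principal_angles X Y 0 i) =
    Num.sqrt (1 - sigma (rev_ord i) ^+ 2) * (sigma (rev_ord i))^-1.
  by rewrite /tan sinE cosE.
have sin_dec := antitone_sines s_dec s_ge0.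
have sin_ge0 l : 0 <= Num.sqrt (1 - sigma (rev_ord l) ^+ 2) by exact: sqrtr_ge0.
have sin_sv_dec M := antitoneM sin_dec (sv_dec M) sin_ge0 (sv_ge0 M).
have sin_sv_ge0 M l := mulr_ge0 (sin_ge0 l) (sv_ge0 M l).
(* The sine of each tangent goes into both residual bounds; the inverse cosine is the factor of
   [ritz_submajorized]. *)
have distr (s t c1 c2 : R) : (c1 + c2) * (s * t) = (s * c1 + s * c2) * t by ring.
apply: (ritz_submajorized AJ s_gt0
  (kyfan_bounded_residual A XX1 YY1 VV SSV s_dec s01 PJ PX PY)
  (kyfan_bounded_residual A YY1 XX1 F_unit SSF s_dec s01 PJ PY PX)
  (sin_sv_dec _) (sin_sv_dec _) (sin_sv_ge0 _) (sin_sv_ge0 _)) => i.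
by rewrite mxE tanE distr.
Qed.
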